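(* Let $d\ge 2$ and let $\varphi=\sum_{i=0}^{d-1}\alpha_i e_i\otimes e_i\in\mathbb{C}^d\otimes\mathbb{C}^d$, where $\alpha_0\ge\cdots\ge\alpha_{d-1}>0$ and $\sum_{i=0}^{d-1}\alpha_i^2=1$. There is a unique state $s:\mathcal{O}_d\otimes_{\max}\mathcal{O}_d\to\mathbb{C}$ such that $s(v_i\otimes w_j)=\delta_{ij}\alpha_i$ for each $i,j=0,\dots,d-1$. Moreover, if $\mathcal{M}\subseteq\mathcal{B}(\mathcal{H})$ is a von Neumann algebra and $(R,T,\psi)$ is any bipartite exact embezzlement protocol for $\varphi$ in $(\mathcal{M},\mathcal{M}',\mathcal{H})$ where the marginals $\langle(\cdot)\psi,\psi\rangle$ of $\psi$ on $\mathcal{M}$ and on $\mathcal{M}'$ are faithful, and if $V_i=R_{i0}^*$ and $W_j=T_{j0}^*$ for $i,j=0,\dots,d-1$, then the unital $*$-homomorphism $\pi:\mathcal{O}_d\otimes_{\max}\mathcal{O}_d\to\mathcal{B}(\mathcal{H})$ given by $\pi(v_i\otimes 1)=V_i$ and $\pi(1\otimes w_j)=W_j$ satisfies $s(X)=\langle\pi(X)\psi,\psi\rangle$ for all $X\in\mathcal{O}_d\otimes_{\max}\mathcal{O}_d$.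
   Context: $\mathcal{O}_d$ is the Cuntz algebra: the universal unital $C^*$-algebra generated by $d$ isometries $v_0,\dots,v_{d-1}$ with $v_i^*v_i=1$ for all $i$ and $\sum_{i}v_iv_i^*=1$ ($d$ Cuntz isometries). $v_0,\dots,v_{d-1}$ denote the generators of the first tensor factor and $w_0,\dots,w_{d-1}$ the corresponding generators of the second tensor factor. ($\mathcal{O}_d$ is nuclear, so $\otimes_{\max}=\otimes_{\min}$.) Bipartite exact embezzlement protocol: $(R,T,\psi)$ is a bipartite exact embezzlement protocol for $\varphi$ in $(\mathcal{M},\mathcal{M}',\mathcal{H})$ if $R\in M_d\otimes\mathcal{M}$ (acting on $\mathbb{C}^d\otimes\mathcal{H}$) and $T\in\mathcal{M}'\otimes M_d$ (acting on $\mathcal{H}\otimes\mathbb{C}^d$) are contractions, $\psi\in\mathcal{H}$ is a unit vector, and $(R\otimes I_d)(I_d\otimes T)(e_0\otimes\psi\otimes e_0)=\sum_{i=0}^{d-1}\alpha_i\,e_i\otimes\psi\otimes e_i$, where $\{e_i\}$ is the canonical basis of $\mathbb{C}^d$. Blocks: $R=\sum_{i,j}E_{ij}\otimes R_{ij}$ with $R_{ij}\in\mathcal{M}$, $T=\sum_{i,j}T_{ij}\otimes E_{ij}$ with $T_{ij}\in\mathcal{M}'$, $E_{ij}$ the matrix units of $M_d$. (In the faithful case, $\{V_i\}$ and $\{W_j\}$ are two collections of $d$ Cuntz isometries in $\mathcal{M}$ and $\mathcal{M}'$ respectively, so $\pi$ exists.) *)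

(* Defs.v *)
From HB Require Import structures.
From mathcomp Require Import all_boot all_order all_algebra.
From mathcomp Require Import complex.
From mathcomp Require Import all_classical all_reals topology normedtype.

Set Implicit Arguments.
Unset Strict Implicit.
Unset Printing Implicit Defensive.

Import Order.TTheory GRing.Theory Num.Theory.

Local Open Scope classical_set_scope.
Local Open Scope ring_scope.

(* Hilbert spaces. The form is linear in its first argument and conjugate-linear
   in the second one, so that X |-> inner (X psi) psi is linear in X. *)

HB.mixin Record CompleteNormedModule_isHilbert (C : numClosedFieldType) H
    & CompleteNormedModule C H := {
  inner : {dot H for (@Num.conj C)};
  inner_norm : forall x : H, inner x x = `|x| ^+ 2
}.

#[short(type="hilbertType")]
HB.structure Definition Hilbert (C : numClosedFieldType) :=
  {H of CompleteNormedModule C H & CompleteNormedModule_isHilbert C H}.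

(* Unital C*-algebras. The structure algType requires 1 != 0: the zero algebra
   is excluded. A join of normedModType and algType would have to be declared
   below numDomainType in the hierarchy, hence the norm is a separate operation;
   as for normedModType C, it takes its values in C. *)

HB.mixin Record Algebra_isCStar (C : numClosedFieldType) A
    & GRing.Algebra C A := {
  star : A -> A;
  starK : involutive star;
  starD : {morph star : a b / a + b};
  starZ : forall (c : C) (a : A), star (c *: a) = c^* *: star a;
  starM : forall a b : A, star (a * b) = star b * star a;
  cnorm : A -> C;
  cnormD : forall a b : A, cnorm (a + b) <= cnorm a + cnorm b;
  cnormZ : forall (c : C) (a : A), cnorm (c *: a) = `|c| * cnorm a;
  cnorm0_eq0 : forall a : A, cnorm a = 0 -> a = 0;
  cnormM : forall a b : A, cnorm (a * b) <= cnorm a * cnorm b;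
  cnorm_star : forall a : A, cnorm (star a * a) = cnorm a ^+ 2;
  cnorm_complete : forall u : nat -> A,
    (forall e : C, 0 < e -> exists N, forall m n,
       (N <= m)%N -> (N <= n)%N -> cnorm (u m - u n) < e) ->
    exists a : A, forall e : C, 0 < e -> exists N, forall n,
       (N <= n)%N -> cnorm (u n - a) < e
}.

#[short(type="cstarAlgType")]
HB.structure Definition CStarAlgebra (C : numClosedFieldType) :=
  {A of GRing.Algebra C A & Algebra_isCStar C A}.

Section CStarAlgebras.
Context {C : numClosedFieldType}.

Definition star_hom (A B : cstarAlgType C) (f : A -> B) : Prop :=
  [/\ linear f, {morph f : a b / a * b}, f 1 = 1
    & {morph f : a / star a}].

Definition norm_closed (A : cstarAlgType C) (N : set A) : Prop :=
  forall a, (forall e : C, 0 < e -> exists2 b, N b & cnorm (a - b) < e) -> N a.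

Definition cstar_subalgebra (A : cstarAlgType C) (N : set A) : Prop :=
  [/\ norm_closed N, N 1,
      forall (c : C) a b, N a -> N b -> N (c *: a + b),
      forall a b, N a -> N b -> N (a * b)
    & forall a, N a -> N (star a)].

Definition cstar_generates (A : cstarAlgType C) (S : set A) : Prop :=
  forall N : set A, cstar_subalgebra N -> S `<=` N -> N = setT.

Definition is_state (A : cstarAlgType C) (s : A -> C) : Prop :=
  [/\ scalar s, forall a, 0 <= s (star a * a) & s 1 = 1].

Definition cuntz_isometries d (A : cstarAlgType C) (v : 'I_d -> A) : Prop :=
  (forall i, star (v i) * v i = 1) /\ \sum_i v i * star (v i) = 1.

Definition is_cuntz_algebra d (O : cstarAlgType C) (v : 'I_d -> O) : Prop :=
  [/\ cuntz_isometries v,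
      cstar_generates (range v)
    & forall (B : cstarAlgType C) (u : 'I_d -> B), cuntz_isometries u ->
        exists f : O -> B, star_hom f /\ forall i, f (v i) = u i].

(* T is the maximal tensor product of A and B, with iA a = a (x) 1 and
   iB b = 1 (x) b: it is universal for pairs of commuting unital
   *-homomorphisms on A and B. *)
Definition is_max_tensor (A B T : cstarAlgType C)
    (iA : A -> T) (iB : B -> T) : Prop :=
  [/\ star_hom iA, star_hom iB,
      forall a b, iA a * iB b = iB b * iA a,
      cstar_generates (range iA `|` range iB)
    & forall (D : cstarAlgType C) (f : A -> D) (g : B -> D),
        star_hom f -> star_hom g -> (forall a b, f a * g b = g b * f a) ->
        exists h : T -> D,
          [/\ star_hom h, forall a, h (iA a) = f a & forall b, h (iB b) = g b]].

Definition elem_tensor (A B T : cstarAlgType C) (iA : A -> T) (iB : B -> T)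
  (a : A) (b : B) : T := iA a * iB b.

End CStarAlgebras.

Section Operators.
Context {C : numClosedFieldType} {H : hilbertType C}.
Implicit Types (S X : H -> H) (M : set (H -> H)).

Definition bounded_op : set (H -> H) :=
  [set X | linear X /\ exists k : C, forall x, `|X x| <= k * `|x|].

(* The adjoint of a bounded operator exists by the Riesz representation
   theorem; [adj X] is a junk value for a function X without adjoint. *)
Definition adj X : H -> H :=
  xget (0 : H -> H) [set S | forall x y, inner (X x) y = inner x (S y)].

Definition commutant M : set (H -> H) :=
  [set S | bounded_op S /\ forall X, M X -> S \o X = X \o S].

Definition von_neumann_algebra M : Prop :=
  [/\ M `<=` bounded_op, forall X, M X -> M (adj X)
    & commutant (commutant M) = M].

(* faithfulness of X |-> <X psi, psi> on M *)
Definition faithful_marginal M (psi : H) : Prop :=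
  forall X, M X -> inner ((adj X \o X) psi) psi = 0 -> X = 0.

(* unital *-homomorphism A -> B(H) *)
Definition is_representation (A : cstarAlgType C) (p : A -> H -> H) : Prop :=
  (forall a, bounded_op (p a)) /\
  [/\ linear p, forall a b, p (a * b) = p a \o p b, p 1 = idfun
    & forall a, p (star a) = adj (p a)].

(* C^d (x) H and H (x) C^d are both encoded as 'I_d -> H, and
   C^d (x) H (x) C^d as 'I_d -> 'I_d -> H: the family xi stands for
   \sum_i e_i (x) xi i, resp. \sum_(i, j) e_i (x) xi i j (x) e_j. *)

Definition block_op d (X : 'I_d -> 'I_d -> H -> H) (xi : 'I_d -> H) :
    'I_d -> H :=
  fun i => \sum_j X i j (xi j).

Definition block_contraction d (X : 'I_d -> 'I_d -> H -> H) : Prop :=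
  forall xi : 'I_d -> H,
    \sum_i `|block_op X xi i| ^+ 2 <= \sum_i `|xi i| ^+ 2.

(* X (x) I_d and I_d (x) X on C^d (x) H (x) C^d *)
Definition ampl_left d (X : 'I_d -> 'I_d -> H -> H)
    (xi : 'I_d -> 'I_d -> H) : 'I_d -> 'I_d -> H :=
  fun i k => block_op X (xi^~ k) i.

Definition ampl_right d (X : 'I_d -> 'I_d -> H -> H)
    (xi : 'I_d -> 'I_d -> H) : 'I_d -> 'I_d -> H :=
  fun i k => block_op X (xi i) k.

(* e_i (x) x (x) e_j *)
Definition basis_tensor d (i : 'I_d) (x : H) (j : 'I_d) : 'I_d -> 'I_d -> H :=
  fun k l => if (k == i) && (l == j) then x else 0.

(* (R, T, psi) is a bipartite exact embezzlement protocol in (M, N, H) for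
   \sum_i alpha_i e_i (x) e_i; i0 is the index of the basis vector e_0. *)
Definition embezzlement_protocol d (i0 : 'I_d) (alpha : 'I_d -> C)
    (M N : set (H -> H)) (R T : 'I_d -> 'I_d -> H -> H) (psi : H) : Prop :=
  [/\ forall i j, M (R i j), forall i j, N (T i j),
      block_contraction R /\ block_contraction T,
      `|psi| = 1
    & ampl_left R (ampl_right T (basis_tensor i0 psi i0))
      = \sum_i alpha i *: basis_tensor i psi i].

End Operators.

(* Main.v *)
(* The Cuntz isometries of a protocol satisfy (v_i w_j)^* psi = delta_ij alpha_i psi,
   hence v_i^* psi = alpha_i w_i psi and w_i^* psi = alpha_i v_i psi. The same holds
   in the GNS representation of any state with s(v_i w_j) = delta_ij alpha_i, by the
   equality case of the Cauchy-Schwarz inequality, because sum_i alpha_i^2 = 1. So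
   modulo the left kernel of s every word is a combination of the v_I w_J, and
   s(v_I w_J) = delta_IJ alpha_I: a nonempty word has s(v_I) = alpha_I^2 s(v_I) with
   alpha_I < 1. This gives uniqueness. For existence, O_d (x) O_d acts on
   l^2(N x N) by base d digit shifts in each coordinate; there the isometry
   Phi = sum_i alpha_i v_i w_i has a wandering vector, hence unit vectors xi_n with
   Phi xi_n - xi_n -> 0, and s is a limit of their vector states along an
   ultrafilter. For a protocol (R, T, psi), R_{i0} T_{k0} psi = delta_ik alpha_i psi and
   the two faithful marginals force R_{i0}^* and T_{j0}^* to be Cuntz isometries. *)

Require Import Defs.
From HB Require Import structures.
From mathcomp Require Import all_boot all_order all_algebra.
From mathcomp Require Import complex.
From mathcomp Require Import all_classical all_reals topology normedtype.
From mathcomp Require Import sequences.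
From mathcomp Require Import ring lra.

Set Implicit Arguments.
Unset Strict Implicit.
Unset Printing Implicit Defensive.

Import Order.TTheory GRing.Theory Num.Theory.
Import numFieldNormedType.Exports.

Local Open Scope classical_set_scope.
Local Open Scope complex_scope.
Local Open Scope ring_scope.

Local Notation Re := complex.Re.
Local Notation Im := complex.Im.

(** * Complex numbers over a real field *)

(** The proof rests on one notion, [commuting_isometries] in an arbitrary C*-algebra. Its instances
    are the generators of the tensor product, the digit shifts and the operators of a protocol. To
    apply the universal properties to the last two, bounded operators must themselves form a
    [cstarAlgType]; [hspace] and [bop] provide this for abstract Hilbert spaces and for l^2 alike.
    Spectral theory is replaced by a single fact, a square root of 1 - x for self-adjoint x with |x|
    < 1, which makes *-homomorphisms and states contractive. The orthogonality v_i^* v_j = 0 of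
    general Cuntz isometries is established under a state, by positivity. In a word, an adjoint
    v_i^* can be traded for alpha_i w_i only at the right end, where it meets the cyclic vector; so
    the density argument is made for a subspace stable under left multiplication. The wandering
    vector is the delta at (0, 1): its last digits differ, while v_i w_i produces pairs with equal
    last digits, and this is where d >= 2 enters existence. *)

Section ComplexModulus.
Context {K : realType}.
Local Notation C := K[i].
Implicit Types (z w : C).

(** The norm of [K[i]] takes values in [K[i]]; a modulus in [K] gives access to a total order and to
    [lra]. *)
Definition cmod z : K := Re `|z|.

Lemma ger0_ReE z : 0 <= z -> z = (Re z)%:C.
Proof. by move=> z0; rewrite RRe_real // ger0_real. Qed.

Lemma cmodE z : `|z| = (cmod z)%:C.
Proof. exact: ger0_ReE. Qed.

Lemma cmod_ge0 z : 0 <= cmod z.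
Proof. by rewrite -ler0c -cmodE. Qed.

Lemma cmod0 : cmod 0 = 0.
Proof. by rewrite /cmod normr0. Qed.

Lemma cmod0_eq0 z : cmod z = 0 -> z = 0.
Proof. by move=> z0; apply/normr0_eq0; rewrite cmodE z0. Qed.

Lemma cmodM z w : cmod (z * w) = cmod z * cmod w.
Proof. by apply: complexI; rewrite rmorphM /= -!cmodE normrM. Qed.

Lemma cmodD z w : cmod (z + w) <= cmod z + cmod w.
Proof. by rewrite -lecR rmorphD /= -!cmodE ler_normD. Qed.

Lemma cmodN z : cmod (- z) = cmod z.
Proof. by rewrite /cmod normrN. Qed.

Lemma cmodB z w : cmod (z - w) = cmod (w - z).
Proof. by rewrite -cmodN opprB. Qed.

Lemma cmodC z : cmod z^* = cmod z.
Proof. by apply: complexI; rewrite -!cmodE norm_conjC. Qed.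

Lemma cmod_real (x : K) : cmod x%:C = `|x|.
Proof.
apply: complexI; rewrite -cmodE normc_def /= expr0n /= addr0.
by rewrite sqrtr_sqr.
Qed.

Lemma cmod1 : cmod 1 = 1.
Proof. by rewrite -[1]/(1%:C) cmod_real normr1. Qed.

Lemma cmod_sqr z : (cmod z ^+ 2)%:C = z * z^*.
Proof. by rewrite rmorphXn /= -cmodE normCK. Qed.

Lemma cmod_sqrE z : cmod z ^+ 2 = Re z ^+ 2 + Im z ^+ 2.
Proof. by apply: complexI; rewrite rmorphXn /= -cmodE add_Re2_Im2. Qed.

Lemma ler_Re_cmod z : `|Re z| <= cmod z.
Proof. by rewrite -lecR -cmodE normc_ge_Re. Qed.

Lemma ler_Im_cmod z : `|Im z| <= cmod z.
Proof.
rewrite -ler_sqr ?nnegrE ?cmod_ge0 // real_normK ?num_real // cmod_sqrE.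
by rewrite lerDr sqr_ge0.
Qed.

Lemma ler_cmod_ReIm z : cmod z <= `|Re z| + `|Im z|.
Proof.
rewrite -ler_sqr ?nnegrE ?cmod_ge0 ?addr_ge0 //.
rewrite cmod_sqrE sqrrD !real_normK ?num_real //.
by rewrite lerD2r lerDl mulrn_wge0 // mulr_ge0.
Qed.

Lemma ReC z : Re z^* = Re z.
Proof. by case: z. Qed.

Lemma ReM_real (x : K) z : Re (x%:C * z) = x * Re z.
Proof. by case: z => a b; rewrite /= mul0r subr0. Qed.

Lemma conjc_realC (x : K) : (x%:C)^* = x%:C :> C.
Proof. exact: conjc_real. Qed.

Lemma complex_small z : (forall e : K, 0 < e -> cmod z <= e) -> z = 0.
Proof.
move=> h; apply: cmod0_eq0; apply/eqP; rewrite eq_le cmod_ge0 andbT.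
by apply/ler_addgt0Pr => e /h; rewrite add0r.
Qed.

Lemma gt0_complexP (e : C) : 0 < e -> exists2 x : K, 0 < x & e = x%:C.
Proof.
move=> e0; exists (Re e); last by apply: ger0_ReE; apply: ltW.
by rewrite -ltcR -ger0_ReE // ltW.
Qed.

Lemma exp_small (r e : K) : 0 <= r -> r < 1 -> 0 < e ->
  exists N, forall n, (N <= n)%N -> r ^+ n < e.
Proof.
move=> r0 r1 e0.
have [N _ HN] : \forall n \near \oo, r ^+ n < e.
  have /cvgrPdist_lt/(_ e e0) : ((fun n => r ^+ n) @ \oo --> (0 : K))%classic.
    by apply: cvg_expr; rewrite ger0_norm.
  by apply: filterS => n; rewrite sub0r normrN ger0_norm // exprn_ge0.
by exists N => n; apply: HN.
Qed.

Lemma inv_succ_small (e : K) : 0 < e ->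
  exists N, forall n, (N <= n)%N -> n.+1%:R^-1 < e.
Proof.
move=> e0; have := archi_boundP (ltW (_ : 0 < e^-1)); rewrite invr_gt0 => /(_ e0).
set N := Num.bound _ => eN; exists N => n Nn.
rewrite -[e]invrK ltf_pV2 ?posrE ?invr_gt0 ?ltr0n //.
by apply: lt_le_trans eN _; rewrite ler_nat leqW.
Qed.

(** For b > 0 the minimum is at t = 1/b, with value a - q/b. For b = 0 and q > 0 the value t = (a +
    1)/(2q) would give -1. *)
Lemma quadratic_discriminant (a b q : K) : 0 <= a -> 0 <= b -> 0 <= q ->
  (forall t : K, 0 <= a - 2 * t * q + t ^+ 2 * q * b) -> q <= a * b.
Proof.
move=> a0 b0 q0 h; have [b1|] := ltP 0 b; last first.
  move=> b1; have b00 : b = 0 by apply/eqP; rewrite eq_le b1 b0.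
  have [q1|q1] := ltP 0 q; last by rewrite b00 mulr0.
  have := h ((a + 1) / (2 * q)).
  rewrite b00 mulr0 addr0.
  suff -> : 2 * ((a + 1) / (2 * q)) * q = a + 1 by lra.
  by field; rewrite gt_eqF.
have := h b^-1.
have -> : a - 2 * b^-1 * q + b^-1 ^+ 2 * q * b = a - q / b.
  by field; rewrite gt_eqF.
by rewrite subr_ge0 ler_pdivrMr.
Qed.

(** Stated for semidefinite forms, to serve states, inner products and the form <A x, y> of a
    positive operator. The test vectors x - t f(x, y) y turn positivity into
    [quadratic_discriminant] with q = |f(x, y)|^2. *)
Lemma Cauchy_Schwarz_form (V : lmodType C) (f : V -> V -> C) :
  (forall c (x y z : V), f (c *: x + y) z = c * f x z + f y z) ->
  (forall x y, f y x = (f x y)^*) -> (forall x, 0 <= f x x) ->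
  forall x y, cmod (f x y) ^+ 2 <= Re (f x x) * Re (f y y).
Proof.
move=> fl fh fp x y.
apply: quadratic_discriminant; rewrite ?sqr_ge0 -?ler0c -?ger0_ReE //.
move=> t; rewrite -ler0c.
have fr c (u v w : V) : f w (c *: u + v) = c^* * f w u + f w v.
  by rewrite fh fl rmorphD rmorphM /= -!fh.
have := fp (- (t%:C * f x y) *: y + x).
rewrite fl !fr rmorphN rmorphM /= conjc_realC (fh x y).
rewrite !(rmorphD, rmorphB, rmorphM, rmorphN) /= -!ger0_ReE //.
rewrite -expr2 normCK rmorph1 => h; congr (0 <= _) : h.
by ring.
Qed.

End ComplexModulus.

(** * C*-algebras *)

Section CStarNorm.
Context {K : realType} {A : cstarAlgType K[i]}.
Local Notation C := K[i].
Implicit Types (a b x y z : A) (c : C) (u : nat -> A).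

Definition rnorm a : K := Re (cnorm a).

(** Triangle inequality for a + (- a) = 0. *)
Lemma cnorm_ge0 a : 0 <= cnorm a.
Proof.
have c0 : cnorm (0 : A) = 0 by rewrite -(scale0r 0) cnormZ normr0 mul0r.
have := cnormD a (- 1 *: a); rewrite cnormZ normrN1 mul1r scaleN1r subrr c0.
by rewrite -mulr2n pmulrn_lge0.
Qed.

Lemma cnormE a : cnorm a = (rnorm a)%:C.
Proof. exact/ger0_ReE/cnorm_ge0. Qed.

Lemma rnorm_ge0 a : 0 <= rnorm a.
Proof. by rewrite -ler0c -cnormE cnorm_ge0. Qed.

Lemma rnormZ c a : rnorm (c *: a) = cmod c * rnorm a.
Proof. by apply: complexI; rewrite rmorphM /= -cmodE -!cnormE cnormZ. Qed.

Lemma rnormD a b : rnorm (a + b) <= rnorm a + rnorm b.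
Proof. by rewrite -lecR rmorphD /= -!cnormE cnormD. Qed.

Lemma rnormM a b : rnorm (a * b) <= rnorm a * rnorm b.
Proof. by rewrite -lecR rmorphM /= -!cnormE cnormM. Qed.

Lemma rnorm0 : rnorm (0 : A) = 0.
Proof. by rewrite -(scale0r 0) rnormZ cmod0 mul0r. Qed.

Lemma rnorm0_eq0 a : rnorm a = 0 -> a = 0.
Proof. by move=> a0; apply: cnorm0_eq0; rewrite cnormE a0. Qed.

Lemma rnormN a : rnorm (- a) = rnorm a.
Proof. by rewrite -scaleN1r rnormZ cmodN cmod1 mul1r. Qed.

Lemma rnorm_distC a b : rnorm (a - b) = rnorm (b - a).
Proof. by rewrite -rnormN opprB. Qed.

Lemma rnormB a b : rnorm (a - b) <= rnorm a + rnorm b.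
Proof. by rewrite (le_trans (rnormD _ _)) ?rnormN. Qed.

Lemma rnorm_starM a : rnorm (star a * a) = rnorm a ^+ 2.
Proof. by apply: complexI; rewrite rmorphXn /= -!cnormE cnorm_star. Qed.

Lemma rnorm_star a : rnorm (star a) = rnorm a.
Proof.
have h x : rnorm x <= rnorm (star x).
  have [x0|x0] := eqVneq (rnorm x) 0; first by rewrite x0 rnorm_ge0.
  have x1 : 0 < rnorm x by rewrite lt_neqAle eq_sym x0 rnorm_ge0.
  by rewrite -(ler_pM2r x1) -expr2 -rnorm_starM rnormM.
by apply/eqP; rewrite eq_le h -{2}(starK a) h.
Qed.

Lemma rnorm_small a : (forall e : K, 0 < e -> rnorm a <= e) -> a = 0.
Proof.
move=> h; apply: rnorm0_eq0; apply/eqP; rewrite eq_le rnorm_ge0 andbT.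
by apply/ler_addgt0Pr => e /h; rewrite add0r.
Qed.

Lemma star0 : star (0 : A) = 0.
Proof. by rewrite -(scale0r 0) starZ conjC0 !scale0r. Qed.

Lemma starN a : star (- a) = - star a.
Proof. by rewrite -scaleN1r starZ rmorphN rmorph1 scaleN1r. Qed.

Lemma starB a b : star (a - b) = star a - star b.
Proof. by rewrite starD starN. Qed.

Lemma star1 : star (1 : A) = 1.
Proof. by rewrite -[RHS]starK -[in RHS](mul1r (star 1)) starM starK mul1r. Qed.

Lemma star_sum (I : Type) (r : seq I) (F : I -> A) :
  star (\sum_(i <- r) F i) = \sum_(i <- r) star (F i).
Proof. exact: (big_morph _ starD star0). Qed.

Lemma norm_closedP (N : set A) a : norm_closed N ->
  (forall e : K, 0 < e -> exists2 b, N b & rnorm (a - b) < e) -> N a.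
Proof.
move=> Ncl h; apply: Ncl => _ /gt0_complexP[e /h[b Nb abe] ->].
by exists b => //; rewrite cnormE ltcR.
Qed.

Lemma norm_closedI (N : set A) :
  (forall a, (forall e : K, 0 < e -> exists2 b, N b & rnorm (a - b) < e) ->
    N a) -> norm_closed N.
Proof.
move=> h a Na; apply: h => e e0; have [|b Nb abe] := Na e%:C.
  by rewrite ltcR.
by exists b => //; rewrite -ltcR -cnormE.
Qed.

Definition tends u a :=
  forall e : K, 0 < e -> exists N, forall n, (N <= n)%N -> rnorm (u n - a) < e.

Lemma rnorm_complete u :
  (forall e : K, 0 < e -> exists N, forall m n,
     (N <= m)%N -> (N <= n)%N -> rnorm (u m - u n) < e) ->
  exists a, tends u a.
Proof.
move=> h; have [|a ua] := @cnorm_complete _ _ u.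
  move=> _ /gt0_complexP[e /h[N HN] ->]; exists N => m n Nm Nn.
  by rewrite cnormE ltcR HN.
exists a => e e0; have [|N HN] := ua e%:C; first by rewrite ltcR.
by exists N => n /HN; rewrite cnormE ltcR.
Qed.

Lemma tends_unique u a b : tends u a -> tends u b -> a = b.
Proof.
move=> ua ub; apply/subr0_eq/rnorm_small => e e0.
have [|N1 H1] := ua (e / 2); first by lra.
have [|N2 H2] := ub (e / 2); first by lra.
have := H1 _ (leq_maxl N1 N2); have := H2 _ (leq_maxr N1 N2).
set n := maxn _ _ => h1 h2; have := rnormD (a - u n) (u n - b).
by rewrite subrKA rnorm_distC; lra.
Qed.

Lemma tends_le u v a b (k : K) : tends u a -> 0 <= k ->
  (forall n, rnorm (v n - b) <= k * rnorm (u n - a)) -> tends v b.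
Proof.
move=> ua k0 h e e0; have [|N HN] := ua (e / (k + 1)).
  by rewrite divr_gt0 // ltr_wpDl.
exists N => n /HN; rewrite ltr_pdivlMr ?ltr_wpDl // => h1.
apply: le_lt_trans (h n) (le_lt_trans _ h1).
by rewrite mulrC ler_wpM2l ?rnorm_ge0 // lerDl.
Qed.

Lemma tends_star u a : tends u a -> tends (star \o u) (star a).
Proof.
move=> ua; apply: (tends_le ua ler01) => n.
by rewrite /= -starB rnorm_star mul1r.
Qed.

Lemma tendsMl x u a : tends u a -> tends (fun n => x * u n) (x * a).
Proof.
by move=> ua; apply: (tends_le ua (rnorm_ge0 x)) => n; rewrite -mulrBr rnormM.
Qed.

Lemma tendsMr x u a : tends u a -> tends (fun n => u n * x) (a * x).
Proof.
move=> ua; apply: (tends_le ua (rnorm_ge0 x)) => n.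
by rewrite -mulrBl mulrC (le_trans (rnormM _ _)) // mulrC.
Qed.

Lemma tends_shift u a : tends u a -> tends (fun n => u n.+1) a.
Proof.
by move=> ua e /ua[N HN]; exists N => n Nn; apply/HN/leqW.
Qed.

(** With p = h + i m, the C*-identity reads |p|^2 = |h^2 + m^2|, and 2h = p + p^* gives |h| <= |p|.
    It stands in for the order relation h^2 <= h^2 + m^2. *)
Lemma norm_sqD_comm h m : star h = h -> star m = m -> h * m = m * h ->
  rnorm h ^+ 2 <= rnorm (h * h + m * m).
Proof.
move=> hs ms hm; pose p := h + 'i *: m; pose q := h - 'i *: m.
have pq : star p = q by rewrite starD starZ hs ms conjCi scaleNr.
have ii : 'i * 'i = -1 :> C by rewrite -expr2 sqrCi.
have qp : q * p = h * h + m * m.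
  rewrite mulrDr !mulrBl -!scalerAl -!scalerAr scalerA ii hm.
  by rewrite scaleN1r opprK addrA subrK.
have h2 : 2%:R *: h = p + q.
  by rewrite /p /q scaler_nat mulr2n addrACA subrr addr0.
have := rnormD p q; rewrite -h2 rnormZ -pq rnorm_star.
have -> : cmod (2%:R : C) = 2 
  by rewrite -(rmorph_nat (real_complex K)) cmod_real ger0_norm.
have := rnorm_starM p; rewrite pq qp => -> h3.
by rewrite ler_sqr ?nnegrE ?rnorm_ge0 //; lra.
Qed.

End CStarNorm.

(** * Square roots of 1 - x by a fixed-point iteration *)

Section CStarSqrt.
Context {K : realType} {A : cstarAlgType K[i]}.
Local Notation C := K[i].

(* The fixed point y = (x + y^2)/2 satisfies (1 - y)^2 = 1 - x, and the
   iteration is a contraction of ratio |x| on the ball of radius |x|. *)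
Lemma cstar_sqrt1B (x : A) : star x = x -> rnorm x < 1 ->
  exists b, [/\ star b = b, b * b = 1 - x
    & forall z, z * x = x * z -> z * b = b * z].
Proof.
move=> xs x1; set r := rnorm x; have r0 : 0 <= r by exact: rnorm_ge0.
pose F (y : A) := 2^-1 *: (x + y * y); pose u n := iter n F 0.
have uS n : u n.+1 = F (u n) by [].
have half : cmod (2^-1 : C) = 2^-1.
  rewrite -[2^-1]/(2%:R^-1) -(rmorph_nat (real_complex K)) -fmorphV cmod_real.
  by rewrite ger0_norm // invr_ge0.
have us n : star (u n) = u n.
  elim: n => [|n IH]; first exact: star0.
  by rewrite uS starZ starD starM IH xs fmorphV rmorph_nat.
(* Each iterate is a polynomial in x. This yields the last conclusion, and also the commutations
   that factor differences of squares below. *)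
have uc n z : z * x = x * z -> z * u n = u n * z.
  move=> zx; elim: n => [|n IH]; first by rewrite mulr0 mul0r.
  rewrite uS -scalerAr -scalerAl mulrDr mulrDl zx; congr (_ *: (_ + _)).
  by rewrite mulrA IH -mulrA IH mulrA.
have ur n : rnorm (u n) <= r.
  elim: n => [|n IH]; first by rewrite rnorm0.
  rewrite uS rnormZ half; have := rnormD x (u n * u n).
  have := rnormM (u n) (u n); have := ler_pM (rnorm_ge0 _) (rnorm_ge0 _) IH IH.
  have : r * r <= r by rewrite ler_piMr // ltW.
  by rewrite -/r; lra.
have uu n m : u n * u m = u m * u n.
  by apply: (uc _ _); apply/esym/uc.
have ud n : rnorm (u n.+1 - u n) <= r ^+ n.
  elim: n => [|n IH].
    rewrite subr0 /u /= rnormZ half mulr0 addr0 expr0.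
    by have := ltW x1; rewrite -/r; lra.
  have -> : u n.+2 - u n.+1 = 2^-1 *: ((u n.+1 - u n) * (u n.+1 + u n)).
    rewrite !uS -scalerBr opprD addrACA subrr add0r mulrDr !mulrBl -!uS.
    by rewrite (uu n n.+1) addrA subrK.
  rewrite rnormZ half exprS; have := rnormM (u n.+1 - u n) (u n.+1 + u n).
  have h := rnormD (u n.+1) (u n); have h1 := ur n; have h2 := ur n.+1.
  have h3 : rnorm (u n.+1 + u n) <= 2 * r by lra.
  have := ler_pM (rnorm_ge0 _) (rnorm_ge0 _) IH h3.
  by lra.
(* Telescoped geometric series, multiplied by 1 - r to avoid a division. *)
have uk n k : (1 - r) * rnorm (u (n + k)%N - u n) <= r ^+ n - r ^+ (n + k).
  elim: k => [|k IH]; first by rewrite addn0 !subrr rnorm0 mulr0.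
  rewrite addnS; have := rnormD (u (n + k).+1 - u (n + k)%N) (u (n + k)%N - u n).
  rewrite subrKA exprS => h; have := ud (n + k)%N.
  have r1 : 0 <= 1 - r by rewrite subr_ge0 ltW.
  by move=> /(ler_wpM2l r1) h1; move: h => /(ler_wpM2l r1); rewrite mulrDr; lra.
have [y uy] : exists y, tends u y.
  apply: rnorm_complete => e e0.
  have [|N HN] := @exp_small _ r (e * (1 - r)) r0 x1.
    by rewrite mulr_gt0 // subr_gt0.
  exists N => m n; wlog mn : m n / (n <= m)%N => [hw|] Nm Nn.
    case/orP: (leq_total m n) => mn; last exact: hw.
    by rewrite rnorm_distC hw.
  rewrite -(ltr_pM2l (_ : 0 < 1 - r)) ?subr_gt0 // [ltRHS]mulrC.
  rewrite -(subnKC mn); apply: le_lt_trans (uk _ _) (le_lt_trans _ (HN _ Nn)).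
  by rewrite gerBl exprn_ge0.
have ys : star y = y.
  apply: (tends_unique (tends_star uy)).
  by congr (tends _ y): uy; apply/funext => n /=; rewrite us.
have yc z : z * x = x * z -> z * y = y * z.
  move=> zx; apply: (tends_unique (tendsMl z uy)).
  have -> : (fun n => z * u n) = (fun n => u n * z).
    by apply/funext => n; rewrite uc.
  exact: tendsMr.
(* F is Lipschitz of ratio r on the ball of radius r, which contains the iterates and their limit;
   so the shifted sequence F(u n) tends to F y. *)
have yF : y = F y.
  apply: (tends_unique (tends_shift uy)).
  apply: (@tends_le _ _ u _ y _ r) => // n.
  rewrite uS -scalerBr opprD addrACA subrr add0r rnormZ half.
  have yun : y * u n = u n * y by apply/esym/yc/esym/uc.
  have -> : u n * u n - y * y = (u n - y) * (u n + y).
    by rewrite mulrDr !mulrBl yun addrA subrK.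
  have yr : rnorm y <= r.
    apply/ler_addgt0Pr => e /uy[N /(_ _ (leqnn N))]; rewrite rnorm_distC => h.
    by have := rnormD (y - u N) (u N); rewrite subrK; have := ur N; lra.
  have h3 : rnorm (u n + y) <= 2 * r by have := rnormD (u n) y; have := ur n; lra.
  have := rnormM (u n - y) (u n + y).
  have := ler_wpM2l (rnorm_ge0 (u n - y)) h3; lra.
exists (1 - y); split.
- by rewrite starB star1 ys.
- have y2 : y + y = x + y * y.
    rewrite {1 2}yF -scalerDr -mulr2n -[X in _ *: X]scaler_nat scalerA.
    by rewrite mulVf ?scale1r // pnatr_eq0.
  have -> : x = y + y - y * y by rewrite y2 addrK.
  rewrite mulrBr mulr1 mulrBl mul1r -addrA !opprB opprD; congr (1 + _).
  by rewrite addrCA.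
- by move=> z /yc zy; rewrite mulrBr mulrBl mulr1 mul1r zy.
Qed.

End CStarSqrt.

(** * Contractivity of *-homomorphisms and of states *)

Section Contractivity.
Context {K : realType}.
Local Notation C := K[i].

(** Scaling by 1/(|a| + e) lands in the open unit ball, the domain of [cstar_sqrt1B]; the e keeps
    the inequality strict and covers a = 0. *)
Lemma rnorm_unit_ball (A : cstarAlgType C) (g : A -> K) :
  (forall (k : K) a, 0 <= k -> g (k%:C *: a) = k * g a) ->
  (forall a, rnorm a < 1 -> g a <= 1) -> forall a, g a <= rnorm a.
Proof.
move=> gZ g1 a; apply/ler_addgt0Pr => e e0; set t := _ + e.
have t0 : 0 < t by rewrite ltr_wpDl // rnorm_ge0.
have t1 : 0 <= t^-1 by rewrite invr_ge0 ltW.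
have := g1 (t^-1%:C *: a).
rewrite gZ // rnormZ cmod_real ger0_norm // ![t^-1 * _]mulrC.
by rewrite ltr_pdivrMr // ler_pdivrMr // mul1r ltrDl; apply.
Qed.

Lemma star_hom0 (A B : cstarAlgType C) (f : A -> B) : star_hom f -> f 0 = 0.
Proof.
case=> fl _ _ _; have := fl (-1) 0 0.
by rewrite !scaleN1r oppr0 add0r addNr.
Qed.

Lemma star_homD (A B : cstarAlgType C) (f : A -> B) : star_hom f ->
  {morph f : a b / a + b}.
Proof. by case=> fl _ _ _ a b; have := fl 1 a b; rewrite !scale1r. Qed.

Lemma star_homZ (A B : cstarAlgType C) (f : A -> B) : star_hom f ->
  forall c a, f (c *: a) = c *: f a.
Proof.
move=> h c a; case: (h) => fl _ _ _; have := fl c a 0.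
by rewrite (star_hom0 h) !addr0.
Qed.

Lemma star_homB (A B : cstarAlgType C) (f : A -> B) : star_hom f ->
  {morph f : a b / a - b}.
Proof.
by move=> h a b; rewrite (star_homD h) -scaleN1r (star_homZ h) scaleN1r.
Qed.

(* If h = h* and |h| < 1, then h^2 + b^2 = 1 for some b = b* commuting with h,
   so f(h)^2 + f(b)^2 = 1 and f(h) is a contraction. *)
Lemma star_hom_rnorm (A B : cstarAlgType C) (f : A -> B) : star_hom f ->
  forall a, rnorm (f a) <= rnorm a.
Proof.
move=> fh; case: (fh) => fl fM f1 fs.
have sa a : star a = a -> rnorm a < 1 -> rnorm (f a) <= 1.
  move=> as_ a1; have [||b [bs bb bc]] := @cstar_sqrt1B _ _ (a * a).
  - by rewrite starM as_.
  - by rewrite -{1}as_ rnorm_starM expr2 mulr_ilt1 ?rnorm_ge0.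
  have := @norm_sqD_comm _ _ (f a) (f b).
  rewrite -!fs as_ bs -!fM bb bc ?mulrA // -(star_homD fh) addrC subrK f1.
  move=> /(_ erefl erefl erefl).
  (* The C*-identity at 1 gives |1| = |1|^2, hence |1| <= 1. *)
  have := rnorm_starM (1 : B); rewrite star1 mulr1 => h1 h2.
  have : rnorm (1 : B) <= 1.
    have [h0|h0] := eqVneq (rnorm (1 : B)) 0; first by rewrite h0.
    have h3 : 0 < rnorm (1 : B) by rewrite lt_neqAle eq_sym h0 rnorm_ge0.
    by rewrite -(ler_pM2l h3) -expr2 -h1 mulr1.
  by move=> h3; rewrite -ler_sqr ?nnegrE ?rnorm_ge0 ?expr1n //; apply: le_trans h3.
apply: (rnorm_unit_ball (g := rnorm \o f)) => a /=.
- by move=> b b0; rewrite (star_homZ fh) rnormZ cmod_real ger0_norm.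
(* The C*-identity reduces a general a to the self-adjoint a^* a. *)
- move=> a1; rewrite -ler_sqr ?nnegrE ?rnorm_ge0 // expr1n -rnorm_starM -fs -fM.
  apply: sa; first by rewrite starM starK.
  by rewrite rnorm_starM expr2 mulr_ilt1 ?rnorm_ge0.
Qed.

Section States.
Context {A : cstarAlgType C} {s : A -> C}.
Hypothesis s_state : is_state s.

Let sl : scalar s. Proof. by case: s_state. Qed.
Let s1 : s 1 = 1. Proof. by case: s_state. Qed.
Let spos a : 0 <= s (star a * a). Proof. by case: s_state. Qed.

Lemma state0 : s 0 = 0.
Proof. by have := sl (-1) 0 0; rewrite scaleN1r oppr0 add0r mulN1r addNr. Qed.

Lemma stateD a b : s (a + b) = s a + s b.
Proof. by have := sl 1 a b; rewrite scale1r mul1r. Qed.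

Lemma stateZ c a : s (c *: a) = c * s a.
Proof. by have := sl c a 0; rewrite state0 !addr0. Qed.

Lemma stateN a : s (- a) = - s a.
Proof. by rewrite -scaleN1r stateZ mulN1r. Qed.

Lemma stateB a b : s (a - b) = s a - s b.
Proof. by rewrite stateD stateN. Qed.

Lemma state_sum (I : Type) (r : seq I) (F : I -> A) :
  s (\sum_(i <- r) F i) = \sum_(i <- r) s (F i).
Proof. exact: (big_morph _ stateD state0). Qed.

Lemma state_star a : s (star a) = (s a)^*.
Proof.
have h (c : C) : (c * s a + c^* * s (star a))^* = c * s a + c^* * s (star a).
  apply/conj_Creal; suff -> : c * s a + c^* * s (star a) =
      s (star (1 + c *: a) * (1 + c *: a)) - 1 - c * c^* * s (star a * a).
    have cc : 0 <= c * c^* by rewrite -normCK exprn_ge0.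
    apply: rpredB; first by apply: rpredB; apply: ger0_real.
    exact/ger0_real/mulr_ge0.
  rewrite starD star1 starZ mulrDr mulr1 mulrDl mul1r.
  by rewrite -scalerAr -scalerAl !stateD !stateZ s1; ring.
have := h 'i; have := h 1; rewrite !(rmorphD, rmorphM, rmorph1) /= !conjCK conjCi.
rewrite !mul1r !mulNr -!mulrN -!mulrDr => h1 /(mulfI (neq0Ci _)) h2.
have : 2%:R * s (star a) = 2%:R * (s a)^*.
  rewrite !mulr_natl !mulr2n; move: h1 h2 => {h}.
  set x := s a; set y := s (star a); move: (x^*) (y^*) => z w h1 h2.
  have -> : y + y = (x + y) - (x - y) by ring.
  by rewrite -h1 -h2; ring.
by apply: mulfI; rewrite pnatr_eq0.
Qed.

Lemma state_Cauchy_Schwarz a b :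
  cmod (s (star b * a)) ^+ 2 <= Re (s (star a * a)) * Re (s (star b * b)).
Proof.
apply: (@Cauchy_Schwarz_form _ _ (fun a b => s (star b * a))) => //.
- by move=> c x y z; rewrite mulrDr -scalerAr stateD stateZ.
- by move=> x y; rewrite -state_star starM starK.
Qed.

(** This replaces the GNS space: s(a^* a) = 0 says that a kills the cyclic vector. *)
Lemma state_null_mull a b : s (star a * a) = 0 -> s (b * a) = 0.
Proof.
move=> a0; have := state_Cauchy_Schwarz a (star b).
rewrite starK a0 mul0r => h; apply: cmod0_eq0; apply/eqP.
by rewrite -sqrf_eq0 eq_le h sqr_ge0.
Qed.

(** For |a| < 1, 1 - a^* a = b^* b has nonnegative value, so s(a^* a) <= 1; Cauchy-Schwarz against 1
    concludes. *)
Lemma state_rnorm a : cmod (s a) <= rnorm a.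
Proof.
apply: (rnorm_unit_ball (g := cmod \o s)) => {}a /=.
- by move=> b k0; rewrite stateZ cmodM cmod_real ger0_norm.
move=> a1; have [||b [bs bb _]] := @cstar_sqrt1B _ _ (star a * a).
- by rewrite starM starK.
- by rewrite rnorm_starM expr2 mulr_ilt1 ?rnorm_ge0.
have : 0 <= Re (s (star b * b)) by rewrite -ler0c -ger0_ReE.
rewrite bs bb stateB s1 /= => h.
have := state_Cauchy_Schwarz a 1; rewrite star1 !mul1r s1 mulr1 => h1.
rewrite -ler_sqr ?nnegrE ?cmod_ge0 // expr1n (le_trans h1) //.
by rewrite -subr_ge0; case: (s _) h => ? ?.
Qed.

End States.
End Contractivity.

(** * Generating sets *)

Section Generation.
Context {K : realType}.
Local Notation C := K[i].

Lemma cstar_subalgebra_preimage (A B : cstarAlgType C) (f : A -> B)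
    (N : set B) :
  star_hom f -> cstar_subalgebra N -> cstar_subalgebra (f @^-1` N).
Proof.
move=> fh [Ncl N1 Nl Nm Ns]; have [fl fM f1 fs] := fh; split => /=.
- apply: norm_closedI => a ha; apply: (norm_closedP Ncl) => e /ha[b Nb abe].
  exists (f b) => //; rewrite -(star_homB fh).
  exact: le_lt_trans (star_hom_rnorm fh _) abe.
- by rewrite f1.
- by move=> c a b Na Nb; rewrite fl; exact: Nl.
- by move=> a b Na Nb; rewrite fM; exact: Nm.
- by move=> a Na; rewrite fs; exact: Ns.
Qed.

Lemma cstar_subalgebra_eq (A B : cstarAlgType C) (f g : A -> B) :
  star_hom f -> star_hom g -> cstar_subalgebra [set a | f a = g a].
Proof.
move=> fh gh; have [fl fM f1 fs] := fh; have [gl gM g1 gs] := gh; split => /=.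
- apply: norm_closedI => a ha; apply/subr0_eq/rnorm_small => e e0.
  have [|b fgb abe] := ha (e / 2); first by lra.
  have := rnormB (f (a - b)) (g (a - b)).
  have := star_hom_rnorm fh (a - b); have := star_hom_rnorm gh (a - b).
  by rewrite (star_homB fh) (star_homB gh) fgb opprB addrA subrK; lra.
- by rewrite f1 g1.
- by move=> c a b fga fgb; rewrite fl gl fga fgb.
- by move=> a b fga fgb; rewrite fM gM fga fgb.
- by move=> a fga; rewrite fs gs fga.
Qed.

Lemma star_hom_generates_eq (A B : cstarAlgType C) (S : set A) (f g : A -> B) :
  star_hom f -> star_hom g -> cstar_generates S -> {in S, f =1 g} -> f = g.
Proof.
move=> fh gh Sgen fg; have := Sgen _ (cstar_subalgebra_eq fh gh).
move=> h; apply/funext => a; have : [set: A] a by [].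
by rewrite -h // => b Sb /=; apply: fg; rewrite inE.
Qed.

(** Commutation with both b and b^* is required so that the set is stable under the adjoint. *)
Lemma cstar_subalgebra_commute (A B : cstarAlgType C) (f : A -> B) (b : B) :
  star_hom f ->
  cstar_subalgebra [set a | f a * b = b * f a /\ f a * star b = star b * f a].
Proof.
move=> fh; have [fl fM f1 fs] := fh.
have small (c x y : B) : y * c = c * y ->
    rnorm (x * c - c * x) <= 2 * rnorm c * rnorm (x - y).
  move=> yc; have -> : x * c - c * x = (x - y) * c - c * (x - y).
    by rewrite mulrBl mulrBr yc opprB addrA subrK.
  have := rnormB ((x - y) * c) (c * (x - y)).
  by have := rnormM (x - y) c; have := rnormM c (x - y); lra.
have close c a : (forall e : K, 0 < e -> exists2 a',
    f a' * c = c * f a' & rnorm (a - a') < e) -> f a * c = c * f a.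
  move=> h; apply/subr0_eq/rnorm_small => e e0.
  have k0 : 0 < 2 * rnorm c + 1 by have := rnorm_ge0 c; lra.
  have [|a' a'c aa'] := h (e / (2 * rnorm c + 1)); first exact: divr_gt0.
  have := le_trans (star_hom_rnorm fh _) (ltW aa').
  rewrite (star_homB fh) ler_pdivlMr // mulrDr mulr1 => h1.
  have := small _ (f a) _ a'c; have := rnorm_ge0 (f a - f a').
  by lra.
split => /=.
- apply: norm_closedI => a ha; split; apply: close => e /ha[a' [h1 h2] aa'];
  by exists a'.
- by rewrite f1 !mulr1 !mul1r.
- move=> c a a' [h1 h2] [h3 h4]; rewrite fl !mulrDl !mulrDr.
  by rewrite -!scalerAl -!scalerAr h1 h2 h3 h4.
- move=> a a' [h1 h2] [h3 h4]; rewrite fM -!mulrA h3 h4 !mulrA.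
  by rewrite h1 h2.
- move=> a [h1 h2]; rewrite fs; split.
    by apply: (inv_inj starK); rewrite !starM starK h2.
  by apply: (inv_inj starK); rewrite !starM !starK h1.
Qed.

Lemma max_tensor_generates d (O T : cstarAlgType C) (v : 'I_d -> O)
    (iL iR : O -> T) : cstar_generates (range v) -> is_max_tensor iL iR ->
  cstar_generates (range (iL \o v) `|` range (iR \o v)).
Proof.
move=> vgen [Lh Rh _ LRgen _] N Nsub vN.
have h (f : O -> T) : star_hom f -> (forall i, N (f (v i))) -> range f `<=` N.
  move=> fh fN; have := vgen _ (cstar_subalgebra_preimage fh Nsub).
  by move=> h _ [a _ <-]; have : [set: O] a by []; rewrite -h // => _ [i _ <-] /=.
apply: LRgen => // x [] /h; apply => // i; apply: vN; first by left; exists i.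
by right; exists i.
Qed.

(** B is only a subspace, in general neither an algebra nor stable under adjoints, so the generation
    hypothesis cannot be applied to its closure. It is applied to the elements that act on that
    closure. *)
Lemma dense_of_left_invariant (A : cstarAlgType C) (S B : set A) :
  cstar_generates S -> B 1 -> (forall c a b, B a -> B b -> B (c *: a + b)) ->
  (forall x, S x -> forall b, B b -> B (x * b) /\ B (star x * b)) ->
  forall (x : A) (e : K), 0 < e -> exists2 b, B b & rnorm (x - b) < e.
Proof.
move=> Sgen B1 Bl SB.
pose Bc := [set x | forall e : K, 0 < e -> exists2 b, B b & rnorm (x - b) < e].
have B0 : B 0 by rewrite -(addNr 1) -scaleN1r; exact: Bl.
have BBc b : B b -> Bc b.
  by move=> Bb e e0; exists b => //; rewrite subrr rnorm0.
have BcI x : (forall e : K, 0 < e -> exists2 b, Bc b & rnorm (x - b) < e) -> Bc x.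
  move=> h e e0; have [|y By xye] := h (e / 2); first by lra.
  have [|b Bb ybe] := By (e / 2); first by lra.
  exists b => //; have := rnormD (x - y) (y - b); rewrite subrKA.
  by lra.
have near (x y z : A) (k e : K) : 0 <= k -> 0 < e -> rnorm (x - y) < e / (k + 1) ->
    rnorm z <= k -> rnorm ((x - y) * z) < e /\ rnorm (z * (x - y)) < e.
  move=> k0 e0; rewrite ltr_pdivlMr ?ltr_wpDl // => h zk.
  have h1 := ler_wpM2l (rnorm_ge0 (x - y)) zk; have h2 := rnorm_ge0 (x - y).
  by split; [have := rnormM (x - y) z|have := rnormM z (x - y)]; lra.
have epos (k e : K) : 0 <= k -> 0 < e -> 0 < e / (k + 1).
  by move=> k0 e0; rewrite divr_gt0 // ltr_wpDl.
have Bcl c a b : Bc a -> Bc b -> Bc (c *: a + b).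
  move=> Ba Bb e e0; have [|a' Ba' aa'] := Ba (e / 2 / (cmod c + 1)).
    by apply: epos; [exact: cmod_ge0|lra].
  have [|b' Bb' bb'] := Bb (e / 2); first by lra.
  exists (c *: a' + b'); first exact: Bl.
  rewrite opprD addrACA -scalerBr.
  have := rnormD (c *: (a - a')) (b - b'); rewrite rnormZ.
  move: aa'; rewrite ltr_pdivlMr ?ltr_wpDl ?cmod_ge0 //.
  by have := rnorm_ge0 (a - a'); lra.
have Bcmul x : (forall b, B b -> Bc (x * b)) -> forall y, Bc y -> Bc (x * y).
  move=> xB y By; apply: BcI => e e0.
  have [b Bb yb] := By _ (epos (rnorm x) e (rnorm_ge0 _) e0).
  exists (x * b); first exact: xB.
  by rewrite -mulrBr; have [] := near _ _ x _ _ (rnorm_ge0 x) e0 yb (lexx _).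
(* G is a C*-subalgebra because it asks for the action of x and of x^* together; once G is
   everything, x = x 1 lies in the closure. *)
pose G := [set x | forall y, Bc y -> Bc (x * y) /\ Bc (star x * y)].
suff GT : G = setT.
  move=> x; have : G x by rewrite GT.
  by move=> /(_ _ (BBc _ B1))[h _]; rewrite -(mulr1 x); exact: h.
apply: Sgen; last first.
  by move=> x Sx y By; split; apply: Bcmul => // b Bb; have [] := SB _ Sx b Bb;
    move=> *; exact: BBc.
split.
- apply: norm_closedI => x hx y By; split; apply: BcI => e e0;
  have [x' Gx' xx'] := hx _ (epos (rnorm y) e (rnorm_ge0 _) e0);
  have [h1 h2] := Gx' y By.
    exists (x' * y) => //; rewrite -mulrBl.
    by have [] := near _ _ y _ _ (rnorm_ge0 y) e0 xx' (lexx _).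
  exists (star x' * y) => //; rewrite -mulrBl -starB.
  rewrite -rnorm_star starM starK.
  have ys : rnorm (star y) <= rnorm y by rewrite rnorm_star.
  by have [] := near _ _ (star y) _ _ (rnorm_ge0 y) e0 xx' ys.
- by move=> y By; rewrite star1 mul1r.
- move=> c a b Ga Gb y By; have [a1 a2] := Ga y By; have [b1 b2] := Gb y By.
  by rewrite starD starZ !mulrDl -!scalerAl; split; apply: Bcl.
- move=> a b Ga Gb y By; rewrite starM -!mulrA.
  have [b1 b2] := Gb _ By; have [a1 a2] := Ga _ By.
  by split; [have [] := Ga _ b1|have [] := Gb _ a2].
- by move=> a Ga y By; rewrite starK; have [] := Ga y By.
Qed.

End Generation.

(** * Uniqueness of the embezzling state *)

Section EmbezzlingState.
Context {K : realType} {d : nat} {alpha : 'I_d -> K} {A : cstarAlgType K[i]}.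
Local Notation C := K[i].
Hypothesis alpha_norm : \sum_i alpha i ^+ 2 = 1.

(** The remaining relations, for v_i w_j^* and v_i^* w_j^*, are adjoints of the two listed. *)
Definition commuting_isometries (v w : 'I_d -> A) :=
  [/\ cuntz_isometries v, cuntz_isometries w,
      forall i j, v i * w j = w j * v i
    & forall i j, star (v i) * w j = w j * star (v i)].

Definition embezzles (s : A -> C) (v w : 'I_d -> A) :=
  forall i j, s (v i * w j) = (i == j)%:R * (alpha i)%:C.

Lemma commuting_isometries_sym v w :
  commuting_isometries v w -> commuting_isometries w v.
Proof.
move=> [vc wc vw vsw]; split => // i j; apply: (inv_inj starK).
by rewrite !starM starK vsw.
Qed.

Lemma embezzles_sym s v w : commuting_isometries v w ->
  embezzles s v w -> embezzles s w v.
Proof.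
move=> [_ _ vw _] h i j; rewrite -vw h eq_sym.
by have [->|] := eqVneq i j; rewrite ?mul0r.
Qed.

Definition word (v : 'I_d -> A) (I : seq 'I_d) : A := \prod_(i <- I) v i.
Definition weight (I : seq 'I_d) : K := \prod_(i <- I) alpha i.

Lemma word_cons v i I : word v (i :: I) = v i * word v I.
Proof. exact: big_cons. Qed.

Lemma word_rcons v I i : word v (rcons I i) = word v I * v i.
Proof. by rewrite /word -cats1 big_cat big_seq1. Qed.

Lemma weight_cons i I : weight (i :: I) = alpha i * weight I.
Proof. exact: big_cons. Qed.

Lemma word_commute v x I : (forall i, v i * x = x * v i) ->
  word v I * x = x * word v I.
Proof.
move=> vx; elim: I => [|i I IH]; first by rewrite /word big_nil mul1r mulr1.
by rewrite word_cons -mulrA IH !mulrA vx.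
Qed.

(** With F_k = v_k^* v_j y, the relation sum_k v_k v_k^* = 1 gives sum_k s(F_k^* F_k) = s(y^* y).
    The term k = j already equals the total, so every other F_k is null for s. *)
Lemma state_isometry_orth (s : A -> C) (v : 'I_d -> A) i j x y :
  is_state s -> cuntz_isometries v ->
  s (x * (star (v i) * (v j * y))) = (i == j)%:R * s (x * y).
Proof.
move=> ss [vv v1]; have [<-|ij] := eqVneq i j.
  by rewrite (mulrA (star _)) vv !mul1r.
rewrite mul0r; apply: (state_null_mull ss).
have ge0 a : 0 <= s (star a * a) by case: ss.
pose F k := star (v k) * (v j * y).
have Fj : F j = y by rewrite /F mulrA vv mul1r.
have sumF : \sum_k s (star (F k) * F k) = s (star y * y).
  rewrite -(state_sum ss); congr (s _).
  transitivity (star (v j * y) * (\sum_k v k * star (v k)) * (v j * y)).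
    rewrite mulr_sumr mulr_suml; apply: eq_bigr => k _.
    by rewrite /F starM starK !mulrA.
  by rewrite v1 mulr1 starM -mulrA -/(F j) Fj.
move: sumF; rewrite (bigD1 j) //= Fj => /(canRL (addKr _)); rewrite addNr.
move=> /(psumr_eq0P (fun k _ => ge0 (F k))); apply; exact: ij.
Qed.

Section Relations.
Context {s : A -> C} {v w : 'I_d -> A}.
Hypotheses (s_state : is_state s) (vw : commuting_isometries v w).
Hypothesis sE : embezzles s v w.

(* In the GNS representation, (v_i w_j)^* psi = delta_ij alpha_i psi. *)
Lemma embezzles_star_mul x i j :
  s (x * (star (w j) * star (v i))) = (i == j)%:R * (alpha i)%:C * s x.
Proof.
have [[_ v1] [_ w1] _ _] := vw.
pose c i j : C := (i == j)%:R * (alpha i)%:C.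
have cr i' j' : (c i' j')^* = c i' j' by rewrite rmorphM rmorph_nat /= conjc_realC.
pose p i j := v i * w j; pose e i j := star (p i j) - (c i j)%:A.
have ge0 a : 0 <= s (star a * a) by case: s_state.
have eE i' j' : s (star (e i' j') * e i' j') =
    s (p i' j' * star (p i' j')) - c i' j' * c i' j'.
  have [_ _ s1] := s_state.
  rewrite /e starB starK starZ star1 cr mulrBr !mulrBl mulr_algr mulr_algl.
  rewrite -scalerAl mul1r !(stateB s_state) !(stateZ s_state) (state_star s_state).
  by rewrite (sE i' j') s1 -/(c i' j') cr; ring.
have sumE : \sum_i' \sum_j' s (star (e i' j') * e i' j') = 0.
  transitivity (\sum_i' (s (v i' * star (v i')) - (alpha i' ^+ 2)%:C)).
    apply: eq_bigr => i' _; under eq_bigr do rewrite eE.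
    rewrite sumrB; congr (_ - _).
      rewrite -(state_sum s_state) -[X in _ = s (X * _)](mulr1 (v i')) -w1 mulr_sumr mulr_suml.
      by congr (s _); apply: eq_bigr => j' _; rewrite starM !mulrA.
    rewrite (bigD1 i') //= big1 => [|j' ji]; last first.
      by rewrite /c eq_sym (negbTE ji) !mul0r.
    by rewrite /c eqxx mul1r addr0 rmorphXn.
  rewrite sumrB -(state_sum s_state) v1 -rmorph_sum alpha_norm /=.
  by case: s_state => _ _ ->; rewrite subrr.
have e0 : s (star (e i j) * e i j) = 0.
  have h1 := psumr_eq0P (fun i' _ => sumr_ge0 _ (fun j' _ => ge0 (e i' j'))) sumE.
  exact: psumr_eq0P (fun j' _ => ge0 (e i j')) (h1 i isT) j isT.
have := state_null_mull s_state x e0.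
rewrite /e /p starM mulrBr mulr_algr (stateB s_state) (stateZ s_state).
by move/subr0_eq.
Qed.

(** Insert 1 = sum_j w_j w_j^* before v_i^*; only j = i survives. *)
Lemma embezzles_star_r x i : s (x * star (v i)) = (alpha i)%:C * s (x * w i).
Proof.
have [_ [_ w1] _ _] := vw.
transitivity (s (x * (\sum_j w j * star (w j)) * star (v i))).
  by rewrite w1 mulr1.
rewrite mulr_sumr mulr_suml (state_sum s_state) (bigD1 i) //= big1 => [|j ji].
  by rewrite addr0 mulrA -mulrA embezzles_star_mul eqxx mul1r.
rewrite mulrA -mulrA embezzles_star_mul eq_sym (negbTE ji).
by rewrite !mul0r.
Qed.

Lemma embezzles_l x i : s (v i * x) = (alpha i)%:C * s (star (w i) * x).
Proof.
rewrite -[LHS]conjCK -(state_star s_state) starM embezzles_star_r rmorphM /=.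
by rewrite -(state_star s_state) starM starK conjc_realC.
Qed.

Lemma embezzles_word_l I x :
  s (word v I * x) = (weight I)%:C * s (star (word w I) * x).
Proof.
have [_ _ cvw csvw] := vw.
elim: I x => [|i I IH] x; first by rewrite /word /weight !big_nil star1 rmorph1 !mul1r.
rewrite !word_cons weight_cons -mulrA embezzles_l mulrA -word_commute.
  by rewrite -mulrA IH starM !rmorphM /= !mulrA.
by move=> j; apply: (inv_inj starK); rewrite !starM starK csvw.
Qed.

End Relations.

Lemma embezzles_word s v w I : is_state s -> commuting_isometries v w ->
  embezzles s v w -> (forall i, 0 < alpha i < 1) ->
  s (word v I) = (I == [::])%:R.
Proof.
move=> ss vw sE a01; have wv := commuting_isometries_sym vw.
have sE' := embezzles_sym vw sE.
case: I => [|i I]; first by rewrite /word big_nil; case: ss.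
have : s (word v (i :: I)) = (weight (i :: I) ^+ 2)%:C * s (word v (i :: I)).
  rewrite -{1}[word v _]mulr1 (embezzles_word_l ss vw sE) mulr1.
  rewrite (state_star ss) -[word w _]mulr1 (embezzles_word_l ss wv sE') mulr1.
  rewrite rmorphM /= conjc_realC -(state_star ss) starK mulrA -rmorphM.
  by rewrite -expr2.
move/eqP; rewrite -subr_eq0 -{1}[s _]mul1r -mulrBl mulf_eq0 => /orP[|/eqP ->//].
have w1 : 0 <= weight (i :: I) < 1.
  have : 0 <= weight I <= 1.
    have a01' k : 0 <= alpha k <= 1 by have /andP[/ltW -> /ltW] := a01 k.
    by rewrite /weight prodr_ge0 ?prodr_ile1 // => k _; have /andP[] := a01' k.
  rewrite weight_cons => /andP[w0 w1]; have /andP[a0 a1] := a01 i.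
  by rewrite mulr_ge0 ?(ltW a0) //= (le_lt_trans _ a1) // ler_piMr // ltW.
rewrite -(rmorph1 (real_complex K)) -rmorphB fmorph_eq0 subr_eq0 eq_sym => /eqP h.
by case/andP: w1 => w0; rewrite -(@expr_lt1 _ 2) // h ltxx.
Qed.

(** First letters are peeled off: the leading v_i becomes alpha_i w_i^*, commutes with the rest of
    the v-word and meets w_j, leaving delta_ij. What remains once a word is exhausted falls under
    [embezzles_word]. *)
Lemma embezzles_wordM s v w I J : is_state s -> commuting_isometries v w ->
  embezzles s v w -> (forall i, 0 < alpha i < 1) ->
  s (word v I * word w J) = (I == J)%:R * (weight I)%:C.
Proof.
move=> ss vw sE a01; have [vc wc cvw csvw] := vw.
have wv := commuting_isometries_sym vw; have sE' := embezzles_sym vw sE.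
elim: I J => [|i I IH] [|j J].
- by rewrite /word /weight !big_nil mulr1 rmorph1 mulr1; case: ss.
- rewrite [word v _]big_nil mul1r (embezzles_word _ ss wv sE') //=.
  by rewrite mul0r.
- by rewrite [word w _]big_nil mulr1 (embezzles_word _ ss vw sE) // mul0r.
rewrite !word_cons -mulrA (embezzles_l ss vw sE) mulrA -word_commute; last first.
  by move=> k; apply: (inv_inj starK); rewrite !starM starK csvw.
rewrite -mulrA (state_isometry_orth _ _ _ _ ss wc) IH weight_cons eqseq_cons.
by rewrite -mulnb natrM rmorphM /=; have [->|_] := eqVneq i j; rewrite /=; ring.
Qed.

Lemma embezzling_state_unique (s1 s2 : A -> C) v w :
  commuting_isometries v w -> (forall i, 0 < alpha i < 1) ->
  cstar_generates (range v `|` range w) ->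
  is_state s1 -> embezzles s1 v w -> is_state s2 -> embezzles s2 v w ->
  s1 = s2.
Proof.
move=> vw a01 gen ss1 sE1 ss2 sE2; have [vc wc cvw csvw] := vw.
have wv := commuting_isometries_sym vw; have [_ _ cwv cswv] := wv.
(* The common left kernel of the two states, a left ideal. Taking both at once lets one
   decomposition, a span of words plus N, compare s1 with s2. *)
pose N := [set y | forall x, s1 (x * y) = 0 /\ s2 (x * y) = 0].
have Nmul x y : N y -> N (x * y) by move=> Ny z; rewrite mulrA; exact: Ny.
have Nlin c a b : N a -> N b -> N (c *: a + b).
  move=> Na Nb x; have [a1 a2] := Na x; have [b1 b2] := Nb x.
  by rewrite mulrDr -scalerAr !stateD // !stateZ // a1 a2 b1 b2 !mulr0 !addr0.
have N0 : N 0 by move=> x; rewrite mulr0 !state0.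
pose W I J := word v I * word w J.
pose B := [set a | exists (t : seq (C * seq 'I_d * seq 'I_d)) n,
  N n /\ a = \sum_(x <- t) x.1.1 *: W x.1.2 x.2 + n].
have NB n : N n -> B n.
  by move=> Nn; exists [::], n; split => //; rewrite big_nil add0r.
have WB I J : B (W I J).
  exists [:: (1, I, J)], 0; split => //.
  by rewrite big_seq1 scale1r addr0.
have Bl c a b : B a -> B b -> B (c *: a + b).
  move=> [t [n [Nn ->]]] [u [m [Nm ->]]].
  exists ([seq (c * x.1.1, x.1.2, x.2) | x <- t] ++ u), (c *: n + m).
  split; first exact: Nlin.
  rewrite big_cat big_map scalerDr addrACA scaler_sumr; congr (_ + _ + _).
  by apply: eq_bigr => x _; rewrite scalerA.
have B0 : B 0 by exact: NB.
have BD a b : B a -> B b -> B (a + b).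
  by move=> Ba Bb; rewrite -[a]scale1r; exact: Bl.
have Bmul x : (forall I J, B (x * W I J)) -> forall b, B b -> B (x * b).
  move=> xW _ [t [n [Nn ->]]]; rewrite mulrDr mulr_sumr.
  apply: BD; last exact/NB/Nmul.
  elim: t => [|y t IH]; first by rewrite big_nil.
  by rewrite big_cons -scalerAr; exact: Bl.
have star_orth (v' : 'I_d -> A) i j y : cuntz_isometries v' -> i != j ->
    N (star (v' i) * (v' j * y)).
  move=> vc' ij x; rewrite !(state_isometry_orth _ _ _ _ _ vc') //.
  by rewrite (negbTE ij) !mul0r.
(* Modulo N, an adjoint at the right end is a multiple of a generator of the other family. *)
have star_l v' w' x i : commuting_isometries v' w' ->
    embezzles s1 v' w' -> embezzles s2 v' w' ->
    B (x * w' i) -> B (x * star (v' i)).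
  move=> vw' e1 e2 Bx.
  have -> : x * star (v' i) = (alpha i)%:C *: (x * w' i) +
      x * (star (v' i) - (alpha i)%:C *: w' i).
    by rewrite mulrBr -scalerAr addrC subrK.
  apply: Bl => //; apply/NB/Nmul => z.
  rewrite mulrBr -scalerAr !stateB // !stateZ //.
  by rewrite (embezzles_star_r ss1 vw' e1) (embezzles_star_r ss2 vw' e2) !subrr.
have gens x : (range v `|` range w) x -> forall b, B b ->
    B (x * b) /\ B (star x * b).
  case=> -[i _ <-] b Bb; split; apply: Bmul => // I J; rewrite /W.
  - by rewrite mulrA -word_cons; exact: WB.
  (* If the v-word is empty, v_i^* moves past the w-word to the right end. Otherwise it meets the
     first letter v_k: it cancels it, or the product lies in N. *)
  - case: I => [|k I].
      rewrite [word v _]big_nil mul1r -word_commute => [|j].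
        apply: (star_l _ _ _ _ vw) => //; rewrite -word_rcons.
        by have := WB [::] (rcons J i); rewrite /W [word v _]big_nil mul1r.
      by rewrite csvw.
    rewrite word_cons -mulrA; have [<-|ik] := eqVneq i k.
      by case: vc => vv _; rewrite mulrA vv mul1r; exact: WB.
    exact/NB/star_orth.
  - rewrite mulrA -(word_commute (v := v)) // -mulrA -word_cons; exact: WB.
  - rewrite mulrA -(word_commute (v := v)) => [|j]; last by rewrite cswv.
    case: J => [|k J].
      rewrite [word w _]big_nil mulr1.
      apply: (star_l _ _ _ _ wv); try exact: embezzles_sym.
      rewrite -word_rcons.
      by have := WB (rcons I i) [::]; rewrite /W [word w _]big_nil mulr1.
    rewrite word_cons -mulrA; have [<-|ik] := eqVneq i k.
      by case: wc => ww _; rewrite (mulrA (star _)) ww mul1r; exact: WB.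
    exact/NB/Nmul/star_orth.
have s12B b : B b -> s1 b = s2 b.
  move=> [t [n [Nn ->]]]; have [] := Nn 1; rewrite mul1r => n1 n2.
  rewrite !stateD // n1 n2 !addr0 !state_sum //; apply: eq_bigr => x _.
  by rewrite !stateZ // !embezzles_wordM.
apply/funext => x; apply/subr0_eq/complex_small => e e0.
have B1 : B 1 by have := WB [::] [::]; rewrite /W /word !big_nil mulr1.
have e2 : 0 < e / 2 by lra.
have [b Bb xbe] := dense_of_left_invariant gen B1 Bl gens x e2.
have -> : s1 x - s2 x = s1 (x - b) - s2 (x - b).
  by rewrite !stateB // (s12B _ Bb) opprB addrA subrK.
have := cmodD (s1 (x - b)) (- s2 (x - b)); rewrite cmodN.
have := state_rnorm ss1 (x - b); have := state_rnorm ss2 (x - b); lra.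
Qed.

End EmbezzlingState.

(** * Operators on Hilbert spaces *)

(** Common interface for [hilbertType] and for l^2(X). The nonzero vector [hbase] ensures 1 != 0 in
    the operator algebra, as [cstarAlgType] demands; completeness is phrased with squared norms. *)
Record hspace (K : realType) := Hspace {
  hcar :> lmodType K[i];
  hip : hcar -> hcar -> K[i];
  hip_linear : forall c x y z, hip (c *: x + y) z = c * hip x z + hip y z;
  hip_conj : forall x y, hip y x = (hip x y)^*;
  hip_ge0 : forall x, 0 <= hip x x;
  hip_eq0 : forall x, hip x x = 0 -> x = 0;
  hip_complete : forall u : nat -> hcar,
    (forall e : K, 0 < e -> exists N, forall m n, (N <= m)%N -> (N <= n)%N ->
       Re (hip (u m - u n) (u m - u n)) < e) ->
    exists x, forall e : K, 0 < e -> exists N, forall n, (N <= n)%N ->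
       Re (hip (u n - x) (u n - x)) < e;
  hbase : hcar;
  hbase_neq0 : hbase != 0
}.

Section HspaceTheory.
Context {K : realType} {V : hspace K}.
Local Notation C := K[i].
Implicit Types (x y z : V) (c : C) (u : nat -> V).

Lemma hipDl x y z : hip (x + y) z = hip x z + hip y z.
Proof. by have := hip_linear 1 x y z; rewrite scale1r mul1r. Qed.

Lemma hip0l x : hip 0 x = 0.
Proof. by apply: (@addrI _ (hip 0 x)); rewrite -hipDl !addr0. Qed.

Lemma hipZl c x y : hip (c *: x) y = c * hip x y.
Proof. by have := hip_linear c x 0 y; rewrite hip0l !addr0. Qed.

Lemma hipNl x y : hip (- x) y = - hip x y.
Proof. by rewrite -scaleN1r hipZl mulN1r. Qed.

Lemma hipBl x y z : hip (x - y) z = hip x z - hip y z.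
Proof. by rewrite hipDl hipNl. Qed.

Lemma hipDr x y z : hip x (y + z) = hip x y + hip x z.
Proof. by rewrite hip_conj hipDl rmorphD /= -!hip_conj. Qed.

Lemma hip0r x : hip x 0 = 0.
Proof. by rewrite hip_conj hip0l rmorph0. Qed.

Lemma hipZr c x y : hip x (c *: y) = c^* * hip x y.
Proof. by rewrite hip_conj hipZl rmorphM /= -hip_conj. Qed.

Lemma hipNr x y : hip x (- y) = - hip x y.
Proof. by rewrite hip_conj hipNl rmorphN /= -hip_conj. Qed.

Lemma hipBr x y z : hip x (y - z) = hip x y - hip x z.
Proof. by rewrite hipDr hipNr. Qed.

Lemma hip_suml (I : Type) (r : seq I) (F : I -> V) y :
  hip (\sum_(i <- r) F i) y = \sum_(i <- r) hip (F i) y.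
Proof.
by apply: (big_morph (fun x => hip x y)) => [? ?|]; rewrite ?hipDl ?hip0l.
Qed.

Lemma hip_ext x y : (forall z, hip x z = hip y z) -> x = y.
Proof.
by move=> h; apply/subr0_eq/hip_eq0; rewrite hipBl h subrr.
Qed.

Definition hn x : K := Num.sqrt (Re (hip x x)).

Lemma Re_hip_ge0 x : 0 <= Re (hip x x).
Proof. by rewrite -ler0c -ger0_ReE // hip_ge0. Qed.

Lemma hn_ge0 x : 0 <= hn x.
Proof. exact: sqrtr_ge0. Qed.

Lemma hn_sqr x : hn x ^+ 2 = Re (hip x x).
Proof. by rewrite sqr_sqrtr // Re_hip_ge0. Qed.

Lemma hip_hn x : hip x x = (hn x ^+ 2)%:C.
Proof. by rewrite hn_sqr -ger0_ReE // hip_ge0. Qed.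

Lemma hip_Cauchy_Schwarz x y : cmod (hip x y) <= hn x * hn y.
Proof.
rewrite -ler_sqr ?nnegrE ?cmod_ge0 ?mulr_ge0 ?hn_ge0 // exprMn !hn_sqr.
apply: Cauchy_Schwarz_form; [exact: hip_linear|exact: hip_conj|exact: hip_ge0].
Qed.

Lemma hnZ c x : hn (c *: x) = cmod c * hn x.
Proof.
rewrite /hn hipZl hipZr mulrA -cmod_sqr ReM_real sqrtrM ?sqr_ge0 //.
by rewrite sqrtr_sqr ger0_norm ?cmod_ge0.
Qed.

Lemma hnD x y : hn (x + y) <= hn x + hn y.
Proof.
rewrite -ler_sqr ?nnegrE ?addr_ge0 ?hn_ge0 // sqrrD.
have -> : hn (x + y) ^+ 2 = hn x ^+ 2 + (Re (hip x y) + Re (hip x y)) + hn y ^+ 2.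
  have e (z : C) : z + z^* = (Re z + Re z)%:C.
    by rewrite -mulr2n -mulr_natl rmorphM rmorph_nat; exact: addcJ.
  apply: complexI; rewrite -hip_hn hipDl !hipDr (hip_conj x y) !hip_hn.
  have r3 (a p b : K) : (a + p + b)%:C = a%:C + p%:C + b%:C by rewrite !rmorphD.
  by rewrite r3 -e addrA -(addrA (_ ^+ 2)%:C).
rewrite lerD2r lerD2l -mulr2n lerMn2r /=.
exact: le_trans (le_trans (ler_norm _) (ler_Re_cmod _)) (hip_Cauchy_Schwarz _ _).
Qed.

Lemma hn0 : hn 0 = 0.
Proof. by rewrite /hn hip0l sqrtr0. Qed.

Lemma hn_eq0 x : hn x = 0 -> x = 0.
Proof. by move=> x0; apply: hip_eq0; rewrite hip_hn x0 expr0n. Qed.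

Lemma hnN x : hn (- x) = hn x.
Proof. by rewrite -scaleN1r hnZ cmodN cmod1 mul1r. Qed.

Lemma hn_distC x y : hn (x - y) = hn (y - x).
Proof. by rewrite -hnN opprB. Qed.

Lemma hnB x y : hn (x - y) <= hn x + hn y.
Proof. by rewrite (le_trans (hnD _ _)) ?hnN. Qed.

Lemma hn_gt0 x : x != 0 -> 0 < hn x.
Proof.
by move=> x0; rewrite lt_neqAle hn_ge0 andbT eq_sym; apply: contra x0 => /eqP/hn_eq0 ->.
Qed.

Lemma hn_complete u :
  (forall e : K, 0 < e -> exists N, forall m n,
     (N <= m)%N -> (N <= n)%N -> hn (u m - u n) < e) ->
  exists x, forall e : K, 0 < e -> exists N, forall n, (N <= n)%N ->
    hn (u n - x) < e.
Proof.
move=> h; have [|x ux] := @hip_complete _ _ u.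
  move=> e e0; have [|N HN] := h (Num.sqrt e); first by rewrite sqrtr_gt0.
  exists N => m n /HN h1 /h1; rewrite -ltr_sqr ?nnegrE ?hn_ge0 ?sqrtr_ge0 //.
  by rewrite hn_sqr sqr_sqrtr // ltW.
exists x => e e0; have [|N HN] := ux (e ^+ 2); first exact: exprn_gt0.
exists N => n /HN; rewrite -hn_sqr ltr_sqr ?nnegrE ?hn_ge0 //.
exact: ltW.
Qed.

End HspaceTheory.

(** Linearity is not a field: it follows from the existence of an adjoint. Adjoints are explicit for
    shifts; for bounded operators on a [hilbertType] they come from the Riesz theorem. *)
Record bop (K : realType) (V : hspace K) := Bop {
  bfun :> V -> V;
  bfun_adj : exists Y : V -> V, forall x y, hip (bfun x) y = hip x (Y y);
  bfun_bounded : exists k : K, forall x, hn (bfun x) <= k * hn x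
}.

(** * The algebra of bounded operators *)

Section BoundedOperators.
Context {K : realType} {V : hspace K}.
Local Notation C := K[i].
Implicit Types (x y z : V) (c : C) (X Y Z : bop V).

Lemma bopP X Y : (forall x, X x = Y x) -> X = Y.
Proof.
move=> /funext; case: X => X X1 X2; case: Y => Y Y1 Y2 /= XY.
by rewrite {}XY in X1 X2 *; congr Bop; exact: Prop_irrelevance.
Qed.

Lemma bop_linear X c x y : X (c *: x + y) = c *: X x + X y.
Proof.
have [Y XY] := bfun_adj X; apply: hip_ext => z.
by rewrite XY hip_linear -!XY -hip_linear.
Qed.

Lemma bop0 X : X 0 = 0.
Proof.
by have := bop_linear X (-1) 0 0; rewrite !scaleN1r oppr0 addr0 addNr.
Qed.

Lemma bopD X x y : X (x + y) = X x + X y.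
Proof. by have := bop_linear X 1 x y; rewrite !scale1r. Qed.

Lemma bopZ X c x : X (c *: x) = c *: X x.
Proof. by have := bop_linear X c x 0; rewrite bop0 !addr0. Qed.

Lemma bopB X x y : X (x - y) = X x - X y.
Proof. by rewrite bopD -[- y]scaleN1r bopZ scaleN1r. Qed.

Lemma bound_nonneg (f : V -> V) : (exists k : K, forall x, hn (f x) <= k * hn x) ->
  exists2 k : K, 0 <= k & forall x, hn (f x) <= k * hn x.
Proof.
move=> [k h]; exists `|k| => // x; apply: le_trans (h x) _.
by rewrite ler_wpM2r ?hn_ge0 // ler_norm.
Qed.

(** From |g y|^2 = <f (g y), y> <= k |g y| |y|. *)
Lemma adj_bounded (f g : V -> V) (k : K) : 0 <= k ->
  (forall x, hn (f x) <= k * hn x) -> (forall x y, hip (f x) y = hip x (g y)) ->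
  forall y, hn (g y) <= k * hn y.
Proof.
move=> k0 fk fg y; have [->|gy0] := eqVneq (g y) 0.
  by rewrite hn0 mulr_ge0 ?hn_ge0.
rewrite -(ler_pM2l (hn_gt0 gy0)) -expr2 hn_sqr -fg.
apply: le_trans (le_trans (ler_norm _) (ler_Re_cmod _)) _.
apply: le_trans (hip_Cauchy_Schwarz _ _) _.
by rewrite mulrA (mulrC _ k) ler_wpM2r ?hn_ge0.
Qed.

Definition badj_fun X : V -> V := projT1 (cid (bfun_adj X)).

Lemma badj_funE X x y : hip (X x) y = hip x (badj_fun X y).
Proof. exact: projT2 (cid (bfun_adj X)) x y. Qed.

Definition badj X : bop V.
Proof.
apply: (@Bop _ _ (badj_fun X)).
  by exists X => x y; rewrite hip_conj -badj_funE -hip_conj.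
have [k k0 Xk] := bound_nonneg (bfun_bounded X).
by exists k; exact: adj_bounded k0 Xk (badj_funE X).
Defined.

Lemma badjE X x y : hip (X x) y = hip x (badj X y).
Proof. exact: badj_funE. Qed.

Lemma badj_unique X Y : (forall x y, hip (X x) y = hip x (Y y)) -> Y = badj X.
Proof.
move=> h; apply: bopP => y; apply: hip_ext => x.
by rewrite hip_conj -h badjE -hip_conj.
Qed.

Definition bop_id : bop V.
Proof. by apply: (@Bop _ _ id); exists 1 || exists id => // x; rewrite mul1r. Defined.

Definition bop_zero : bop V.
Proof.
apply: (@Bop _ _ (fun=> 0)); first by exists (fun=> 0) => x y; rewrite hip0l hip0r.
by exists 0 => x; rewrite hn0 mul0r.
Defined.

(** Sum, opposite and scaling are all instances, so adjoints and bounds are constructed once. *)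
Definition bop_lin c X Y : bop V.
Proof.
apply: (@Bop _ _ (fun x => c *: X x + Y x)).
  exists (fun y => c^* *: badj X y + badj Y y) => x y.
  by rewrite hip_linear !badjE hipDr hipZr conjCK.
have [k k0 Xk] := bound_nonneg (bfun_bounded X).
have [l l0 Yl] := bound_nonneg (bfun_bounded Y).
exists (cmod c * k + l) => x; apply: le_trans (hnD _ _) _.
by rewrite mulrDl lerD // hnZ -mulrA ler_wpM2l ?cmod_ge0.
Defined.

Definition bop_comp X Y : bop V.
Proof.
apply: (@Bop _ _ (X \o Y)).
  by exists (badj Y \o badj X) => x y; rewrite /= !badjE.
have [k k0 Xk] := bound_nonneg (bfun_bounded X).
have [l l0 Yl] := bound_nonneg (bfun_bounded Y).
exists (k * l) => x /=; apply: le_trans (Xk _) _.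
by rewrite -mulrA ler_wpM2l.
Defined.

Definition bop_add X Y := bop_lin 1 X Y.
Definition bop_opp X := bop_lin (-1) X bop_zero.
Definition bop_scale c X := bop_lin c X bop_zero.

HB.instance Definition _ := gen_eqMixin (bop V).
HB.instance Definition _ := gen_choiceMixin (bop V).

Let bop_addA : associative bop_add.
Proof. by move=> X Y Z; apply: bopP => x /=; rewrite !scale1r addrA. Qed.

Let bop_addC : commutative bop_add.
Proof. by move=> X Y; apply: bopP => x /=; rewrite !scale1r addrC. Qed.

Let bop_add0 : left_id bop_zero bop_add.
Proof. by move=> X; apply: bopP => x /=; rewrite scale1r add0r. Qed.

Let bop_addN : left_inverse bop_zero bop_opp bop_add.
Proof.
by move=> X; apply: bopP => x /=; rewrite scale1r addr0 scaleN1r addNr.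
Qed.

HB.instance Definition _ :=
  GRing.isZmodule.Build (bop V) bop_addA bop_addC bop_add0 bop_addN.

Lemma bop_addE X Y x : (X + Y) x = X x + Y x.
Proof. by rewrite /= scale1r. Qed.

Lemma bop_oppE X x : (- X) x = - X x.
Proof. by rewrite /= scaleN1r addr0. Qed.

Let bop_mulA : associative bop_comp.
Proof. by move=> X Y Z; exact: bopP. Qed.

Let bop_mul1l : left_id bop_id bop_comp.
Proof. by move=> X; exact: bopP. Qed.

Let bop_mul1r : right_id bop_id bop_comp.
Proof. by move=> X; exact: bopP. Qed.

Let bop_mulDl : left_distributive bop_comp +%R.
Proof. by move=> X Y Z; exact: bopP. Qed.

Let bop_mulDr : right_distributive bop_comp +%R.
Proof. by move=> X Y Z; apply: bopP => x /=; rewrite !scale1r bopD. Qed.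

Let bop_id_neq0 : bop_id != 0.
Proof.
by apply/eqP => /(congr1 (fun X => bfun X (hbase V)))/eqP /=; rewrite (negbTE (hbase_neq0 V)).
Qed.

HB.instance Definition _ := GRing.Zmodule_isNzRing.Build (bop V)
  bop_mulA bop_mul1l bop_mul1r bop_mulDl bop_mulDr bop_id_neq0.

Let bop_scaleA c (c' : C) X : bop_scale c (bop_scale c' X) = bop_scale (c * c') X.
Proof. by apply: bopP => x /=; rewrite !addr0 scalerA. Qed.

Let bop_scale1 : left_id 1 bop_scale.
Proof. by move=> X; apply: bopP => x /=; rewrite addr0 scale1r. Qed.

Let bop_scaleDr : right_distributive bop_scale +%R.
Proof.
by move=> c X Y; apply: bopP => x /=; rewrite !addr0 !scale1r scalerDr.
Qed.

Let bop_scaleDl X : {morph bop_scale^~ X : a b / a + b}.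
Proof. by move=> a b; apply: bopP => x /=; rewrite !addr0 scale1r scalerDl. Qed.

HB.instance Definition _ := GRing.Zmodule_isLmodule.Build C (bop V)
  bop_scaleA bop_scale1 bop_scaleDr bop_scaleDl.

Lemma bop_scaleE c X x : (c *: X) x = c *: X x.
Proof. by rewrite /= addr0. Qed.

Let bop_scaleAl c X Y : c *: (X * Y) = c *: X * Y.
Proof. by apply: bopP => x; rewrite bop_scaleE /= addr0. Qed.

HB.instance Definition _ := GRing.Lmodule_isLalgebra.Build C (bop V) bop_scaleAl.

Let bop_scaleAr c X Y : c *: (X * Y) = X * (c *: Y).
Proof. by apply: bopP => x; rewrite bop_scaleE /= addr0 bopZ. Qed.

HB.instance Definition _ := GRing.Lalgebra_isAlgebra.Build C (bop V) bop_scaleAr.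

End BoundedOperators.

(** * Bounded operators as a C*-algebra *)

Section OperatorNorm.
Context {K : realType} {V : hspace K}.
Local Notation C := K[i].
Implicit Types (x y z : V) (c : C) (X Y Z : bop V).

Definition bnorm X : K := inf [set k | 0 <= k /\ forall x, hn (X x) <= k * hn x].

Let bnorm_inf X : has_inf [set k | 0 <= k /\ forall x, hn (X x) <= k * hn x].
Proof.
split; last by exists 0 => k [].
by have [k k0 Xk] := bound_nonneg (bfun_bounded X); exists k.
Qed.

Lemma bnorm_ge0 X : 0 <= bnorm X.
Proof. by apply: lb_le_inf => [|k []//]; case: (bnorm_inf X). Qed.

Lemma bnorm_le X (k : K) : 0 <= k -> (forall x, hn (X x) <= k * hn x) -> bnorm X <= k.
Proof. by move=> k0 Xk; apply: ge_inf => //; case: (bnorm_inf X). Qed.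

Lemma bnormP X x : hn (X x) <= bnorm X * hn x.
Proof.
have [->|x0] := eqVneq x 0; first by rewrite bop0 !hn0 mulr0.
rewrite -ler_pdivrMr ?hn_gt0 //; apply: lb_le_inf; first by case: (bnorm_inf X).
by move=> k [_ Xk]; rewrite ler_pdivrMr ?hn_gt0.
Qed.

Lemma badjK : involutive (@badj K V).
Proof.
move=> X; apply/esym/badj_unique => x y.
by rewrite hip_conj -badjE -hip_conj.
Qed.

Let badjD : {morph (@badj K V) : X Y / X + Y}.
Proof.
move=> X Y; apply/esym/badj_unique => x y.
by rewrite !bop_addE hipDl hipDr !badjE.
Qed.

Let badjZ c X : badj (c *: X) = c^* *: badj X.
Proof.
apply/esym/badj_unique => x y.
by rewrite !bop_scaleE hipZl hipZr badjE conjCK.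
Qed.

Let badjM X Y : badj (X * Y) = badj Y * badj X.
Proof.
by apply/esym/badj_unique => x y; rewrite -!badjE.
Qed.

Definition bcnorm X : C := (bnorm X)%:C.

Let bcnormD X Y : bcnorm (X + Y) <= bcnorm X + bcnorm Y.
Proof.
rewrite -rmorphD lecR; apply: bnorm_le; first by rewrite addr_ge0 ?bnorm_ge0.
move=> x; rewrite bop_addE mulrDl; apply: le_trans (hnD _ _) _.
by rewrite lerD ?bnormP.
Qed.

Let bnormZ_le c X : bnorm (c *: X) <= cmod c * bnorm X.
Proof.
apply: bnorm_le => [|x]; first by rewrite mulr_ge0 ?cmod_ge0 ?bnorm_ge0.
by rewrite bop_scaleE hnZ -mulrA ler_wpM2l ?cmod_ge0 ?bnormP.
Qed.

Let bcnormZ c X : bcnorm (c *: X) = `|c| * bcnorm X.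
Proof.
rewrite cmodE -rmorphM; congr _%:C; apply/eqP; rewrite eq_le bnormZ_le /=.
have [->|c0] := eqVneq c 0; first by rewrite cmod0 mul0r bnorm_ge0.
have cp : 0 < cmod c.
  rewrite lt_neqAle cmod_ge0 andbT eq_sym; apply: contra c0 => /eqP.
  by move/cmod0_eq0 => ->.
have := bnormZ_le c^-1 (c *: X); rewrite scalerA mulVf // scale1r => h.
have := ler_wpM2l (ltW cp) h.
by rewrite mulrA -cmodM divff // cmod1 mul1r.
Qed.

Let bcnorm0_eq0 X : bcnorm X = 0 -> X = 0.
Proof.
move=> /complexI X0; apply: bopP => x; apply: hn_eq0.
by apply/eqP; rewrite eq_le hn_ge0 andbT; have := bnormP X x; rewrite X0 mul0r.
Qed.

Let bcnormM X Y : bcnorm (X * Y) <= bcnorm X * bcnorm Y.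
Proof.
rewrite -rmorphM lecR; apply: bnorm_le; first by rewrite mulr_ge0 ?bnorm_ge0.
move=> x /=; apply: le_trans (bnormP _ _) _.
by rewrite -mulrA ler_wpM2l ?bnorm_ge0 ?bnormP.
Qed.

Lemma bnorm_adj X : bnorm (badj X) <= bnorm X.
Proof.
by apply: bnorm_le (adj_bounded _ (bnormP X) (badjE X)); rewrite bnorm_ge0.
Qed.

Let bcnorm_star X : bcnorm (badj X * X) = bcnorm X ^+ 2.
Proof.
rewrite -rmorphXn; congr _%:C; apply/eqP; rewrite eq_le; apply/andP; split.
  rewrite expr2; have := bcnormM (badj X) X; rewrite -rmorphM lecR.
  move=> h; apply: le_trans h _.
  by rewrite ler_wpM2r ?bnorm_ge0 ?bnorm_adj.
rewrite -[leRHS]sqr_sqrtr ?bnorm_ge0 // ler_sqr ?nnegrE ?bnorm_ge0 ?sqrtr_ge0 //.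
apply: bnorm_le => [|x]; first exact: sqrtr_ge0.
rewrite -ler_sqr ?nnegrE ?mulr_ge0 ?hn_ge0 ?sqrtr_ge0 // exprMn (sqr_sqrtr (bnorm_ge0 _)).
rewrite hn_sqr badjE.
apply: le_trans (le_trans (ler_norm _) (ler_Re_cmod _)) _.
apply: le_trans (hip_Cauchy_Schwarz _ _) _.
by rewrite [leLHS]mulrC expr2 mulrA ler_wpM2r ?hn_ge0 // (bnormP (badj X * X)).
Qed.

(** The limit must come with an adjoint. The adjoints of a Cauchy sequence are Cauchy as well, by
    [bnorm_adj], and the two pointwise limits stay adjoint to each other. *)
Lemma bop_complete (u : nat -> bop V) :
  (forall e : K, 0 < e -> exists N, forall m n, (N <= m)%N -> (N <= n)%N ->
     bnorm (u m - u n) < e) ->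
  exists X, forall e : K, 0 < e -> exists N, forall n, (N <= n)%N ->
     bnorm (u n - X) < e.
Proof.
move=> uc; pose lim_at (w : nat -> bop V) (f : V -> V) :=
  forall e : K, 0 < e -> exists N, forall n, (N <= n)%N ->
    forall x, hn (w n x - f x) <= e * hn x.
have bopBE X Y x : (X - Y) x = X x - Y x by rewrite bop_addE bop_oppE.
have ptlim (w : nat -> bop V) : (forall e : K, 0 < e -> exists N, forall m n,
     (N <= m)%N -> (N <= n)%N -> bnorm (w m - w n) < e) -> exists f, lim_at w f.
  move=> wc.
  have /choice[f Hf] x : exists y, forall e : K, 0 < e -> exists N, forall n,
      (N <= n)%N -> hn (w n x - y) < e.
    apply: hn_complete => e e0; have k0 : 0 < hn x + 1 by rewrite ltr_wpDl ?hn_ge0.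
    have [|N HN] := wc (e / (hn x + 1)); first exact: divr_gt0.
    exists N => m n Nm Nn; have := HN _ _ Nm Nn; rewrite ltr_pdivlMr //.
    have := bnormP (w m - w n) x; have := bnorm_ge0 (w m - w n).
    by rewrite bopBE; lra.
  exists f => e e0; have [N HN] := wc _ e0; exists N => n Nn x.
  apply/ler_addgt0Pr => t t0; have [N' HN'] := Hf x t t0.
  have := HN' _ (leq_maxr N N'); set m := maxn N N'.
  have := HN _ _ Nn (leq_maxl N N'); rewrite -/m => h1 h2.
  have := hnD (w n x - w m x) (w m x - f x); rewrite subrKA.
  have := bnormP (w n - w m) x; rewrite bopBE.
  have := ler_wpM2r (hn_ge0 x) (ltW h1); lra.
have [f Hf] := ptlim _ uc.
have [g Hg] : exists g, lim_at (fun n => badj (u n)) g.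
  apply: ptlim => e /uc[N HN]; exists N => m n Nm Nn.
  apply: le_lt_trans (HN m n Nm Nn).
  have -> : badj (u m) - badj (u n) = badj (u m - u n).
    by rewrite badjD -scaleN1r -[- u n]scaleN1r badjZ rmorphN rmorph1.
  exact: bnorm_adj.
have fg x y : hip (f x) y = hip x (g y).
  apply/subr0_eq/complex_small => e e0.
  pose k := 2 * (hn x * hn y) + 1.
  have xy0 : 0 <= hn x * hn y by rewrite mulr_ge0 ?hn_ge0.
  have k0 : 0 < k by rewrite /k; lra.
  have ek : 0 < e / k by exact: divr_gt0.
  have [N1 /(_ _ (leq_maxl N1 _)) H1] := Hf _ ek.
  have [N2 /(_ _ (leq_maxr N1 _)) H2] := Hg _ ek.
  move: (H1 N2 x) (H2 y) => {H1 H2}; set n := maxn N1 N2 => h1 h2.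
  have -> : hip (f x) y - hip x (g y) =
      hip x (badj (u n) y - g y) - hip (u n x - f x) y.
    by rewrite hipBr hipBl badjE opprB [RHS]addrC subrKA.
  have := cmodD (hip x (badj (u n) y - g y)) (- hip (u n x - f x) y).
  rewrite cmodN; have := hip_Cauchy_Schwarz (u n x - f x) y.
  have := hip_Cauchy_Schwarz x (badj (u n) y - g y).
  have := ler_wpM2l (hn_ge0 x) h2; have := ler_wpM2r (hn_ge0 y) h1.
  have : e / k * (2 * (hn x * hn y)) <= e.
    rewrite mulrAC ler_pdivrMr // ler_wpM2l ?(ltW e0) // /k; lra.
  by lra.
have fb : exists k : K, forall x, hn (f x) <= k * hn x.
  have [N /(_ N (leqnn N)) HN] := Hf 1 ltr01; exists (bnorm (u N) + 1) => x.
  have := hnB (u N x) (u N x - f x); rewrite subKr.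
  by have := HN x; have := bnormP (u N) x; lra.
exists (Bop (ex_intro _ g fg) fb) => e e0.
have e2 : 0 < e / 2 by lra.
have [N HN] := Hf _ e2; exists N => n Nn; apply: (@le_lt_trans _ _ (e / 2)); last by lra.
by apply: bnorm_le => [|x]; [exact: ltW|rewrite bopBE; exact: HN].
Qed.

Let bcnorm_complete (u : nat -> bop V) :
  (forall e : C, 0 < e -> exists N, forall m n,
     (N <= m)%N -> (N <= n)%N -> bcnorm (u m - u n) < e) ->
  exists X, forall e : C, 0 < e -> exists N, forall n,
     (N <= n)%N -> bcnorm (u n - X) < e.
Proof.
move=> uc; have [|X uX] := bop_complete (u := u).
  move=> e e0; have [|N HN] := uc e%:C; first by rewrite ltcR.
  by exists N => m n Nm /(HN _ _ Nm); rewrite ltcR.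
exists X => _ /gt0_complexP[e /uX[N HN] ->].
by exists N => n /HN; rewrite ltcR.
Qed.

HB.instance Definition _ := Algebra_isCStar.Build C (bop V)
  badjK badjD badjZ badjM bcnormD bcnormZ bcnorm0_eq0 bcnormM bcnorm_star
  bcnorm_complete.

Lemma bop_starE X x y : hip (X x) y = hip x (star X y).
Proof. exact: badjE. Qed.

Lemma bop_subE X Y x : (X - Y) x = X x - Y x.
Proof. by rewrite bop_addE bop_oppE. Qed.

Lemma bop_mulE X Y x : (X * Y) x = X (Y x).
Proof. by []. Qed.

Lemma bop_oneE x : (1 : bop V) x = x.
Proof. by []. Qed.

Lemma bop_sumE (I : Type) (r : seq I) (F : I -> bop V) x :
  (\sum_(i <- r) F i) x = \sum_(i <- r) F i x.
Proof.
by apply: (big_morph (fun X : bop V => X x)) => // X Y; exact: bop_addE.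
Qed.

Lemma vector_state (A : cstarAlgType C) (f : A -> bop V) x :
  star_hom f -> hip x x = 1 -> is_state (fun a => hip (f a x) x).
Proof.
move=> fh x1; have [fl fM f1 fs] := fh; split.
- by move=> c a b; rewrite fl bop_addE bop_scaleE hip_linear.
- move=> a; rewrite fM fs bop_mulE hip_conj -bop_starE.
  by rewrite conj_Creal ?ger0_real ?hip_ge0.
- by rewrite f1.
Qed.

End OperatorNorm.

(** * The Riesz representation theorem *)

Section Riesz.
Context {K : realType} {V : hspace K}.
Local Notation C := K[i].
Implicit Types (x y z : V).

(* Minimizes |x|^2 - 2 Re (phi x); the parallelogram identity makes every
   minimizing sequence Cauchy. *)
Lemma Riesz_representation (phi : V -> C) : scalar phi ->
  (exists k : K, forall x, cmod (phi x) <= k * hn x) ->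
  exists z, forall x, phi x = hip x z.
Proof.
move=> phil [k phik].
have phi0 : phi 0 = 0 by have := phil (-1) 0 0; rewrite scaleN1r oppr0 add0r mulN1r addNr.
have phiD x y : phi (x + y) = phi x + phi y.
  by have := phil 1 x y; rewrite scale1r mul1r.
have phiZ (c : C) x : phi (c *: x) = c * phi x.
  by have := phil c x 0; rewrite phi0 !addr0.
pose f x := Re (phi x); pose g x y := Re (hip x y).
have fD x y : f (x + y) = f x + f y by rewrite /f phiD; case: (phi x) (phi y) => ? ? [].
have fZ (t : K) x : f (t%:C *: x) = t * f x by rewrite /f phiZ ReM_real.
have gD x y z : g (x + y) z = g x z + g y z.
  by rewrite /g hipDl; case: (hip x z) (hip y z) => ? ? [].
have gZ (t : K) x y : g (t%:C *: x) y = t * g x y by rewrite /g hipZl ReM_real.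
have gC x y : g x y = g y x by rewrite /g hip_conj ReC.
have gDr x y z : g x (y + z) = g x y + g x z by rewrite !(gC x) gD.
have gZr (t : K) x y : g x (t%:C *: y) = t * g x y by rewrite !(gC x) gZ.
pose J x := g x x - 2 * f x.
(* From |x|^2 - 2k|x| = (|x| - k)^2 - k^2. *)
have J_ge x : - k ^+ 2 <= J x.
  have := le_trans (le_trans (ler_norm _) (ler_Re_cmod _)) (phik x).
  rewrite -/(f x) /J /g -hn_sqr => h; have := sqr_ge0 (hn x - k).
  by rewrite sqrrB; lra.
have Jinf : has_inf (range J).
  by split; [exists (J 0), 0|exists (- k ^+ 2) => _ [x _ <-]].
have [m Jm Hm] : exists2 m : K, forall x, m <= J x &
    forall e : K, 0 < e -> exists x, J x < m + e.
  exists (inf (range J)) => [x|e e0]; first by apply: ge_inf; [case: Jinf|exists x].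
  by have [_ [x _ <-] ?] := inf_adherent e0 Jinf; exists x.
have /choice[u Hu] (n : nat) : exists x, J x < m + n.+1%:R^-1.
  by apply: Hm; rewrite invr_gt0.
have J2 x y : g (x - y) (x - y) = 2 * J x + 2 * J y - 4 * J (2^-1%:C *: (x + y)).
  rewrite /J -[- y]scaleN1r -(rmorph1 (real_complex K)) -rmorphN.
  rewrite !(gZ, gZr, fZ, gD, gDr, fD) (gC y x); by field.
have [x ux] : exists x, forall e : K, 0 < e -> exists N, forall n, (N <= n)%N ->
    hn (u n - x) < e.
  (* The midpoint term of [J2] is at least m, so |u p - u q|^2 < 2/(p+1) + 2/(q+1); hence the
     tolerance e^2/4. *)
  apply: hn_complete => e e0; have [|N HN] := @inv_succ_small K (e ^+ 2 / 4).
    by rewrite divr_gt0 ?exprn_gt0.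
  exists N => p q /HN Np /HN Nq; rewrite -ltr_sqr ?nnegrE ?hn_ge0 ?(ltW e0) //.
  rewrite hn_sqr -/(g _ _) J2; have := Jm (2^-1%:C *: (u p + u q)).
  move: Np Nq (Hu p) (Hu q).
  by move: (J _) (J _) (J _) p.+1%:R^-1 q.+1%:R^-1 => *; lra.
exists x => y; apply/esym/subr0_eq.
(* First-order condition at the minimum. Instead of continuity of J, the proof compares J (u n) < m
   + 1/(n+1) with m <= J (u n + t z) and lets n grow. *)
have Re0 z : Re (hip z x - phi z) = 0.
  have -> : Re (hip z x - phi z) = g x z - f z.
    by rewrite gC /g /f; case: (hip z x) (phi z) => ? ? [].
  set q := _ - _; set b := g z z; have b0 : 0 <= b by exact: Re_hip_ge0.
  have h (t : K) : 0 <= 2 * t * q + t ^+ 2 * b.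
    apply/ler_addgt0Pr => e e0.
    pose l := 2 * `|t| * hn z + 1.
    have l0 : 0 < l by rewrite ltr_wpDl ?mulr_ge0 ?hn_ge0.
    have [|N1 H1] := @inv_succ_small K (e / 2); first by lra.
    have [|N2 H2] := ux (e / 2 / l); first by rewrite !divr_gt0.
    have := H1 _ (leq_maxl N1 N2); have := H2 _ (leq_maxr N1 N2).
    set n := maxn N1 N2 => h1 h2; move: h1; rewrite ltr_pdivlMr // => h1.
    have := Jm (u n + t%:C *: z); have := Hu n.
    rewrite /J !(gD, gDr, fD) !(gZ, gZr, fZ) -/b (gC z (u n)) => h3 h4.
    have h5 : 2 * t * (g (u n) z - g x z) <= 2 * `|t| * (hn (u n - x) * hn z).
      have -> : g (u n) z - g x z = g (u n - x) z.
        by rewrite /g hipBl; case: (hip (u n) z) (hip x z) => ? ? [].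
      rewrite -!mulrA ler_pM2l // (le_trans (ler_norm _)) // normrM ler_wpM2l //.
      exact: le_trans (ler_Re_cmod _) (hip_Cauchy_Schwarz _ _).
    have h6 : 2 * `|t| * (hn (u n - x) * hn z) <= e / 2.
      by have := hn_ge0 (u n - x); rewrite /l in h1; lra.
    rewrite /q; move: h2 h3 h4 h5 h6.
    move: n.+1%:R^-1 (g (u n) (u n)) (g (u n) z) (g x z) (f (u n)) (f z).
    by move: (2 * `|t| * _); clear; move: b (e) => *; lra.
  have b1 : 0 < b + 1 by lra.
  (* Near the minimizer - q / b of the quadratic; the denominator b + 1 cannot vanish. *)
  have := h (- q / (b + 1)).
  have -> : 2 * (- q / (b + 1)) * q + (- q / (b + 1)) ^+ 2 * b =
      - (q ^+ 2 * (b + 2)) / (b + 1) ^+ 2 by field; rewrite gt_eqF.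
  rewrite ler_pdivlMr ?exprn_gt0 // mul0r oppr_ge0 pmulr_lle0 ?ltr_wpDl //.
  by move=> q2; apply/eqP; rewrite -sqrf_eq0 eq_le q2 sqr_ge0.
(* The vector i y turns the imaginary part into a real part. *)
have := Re0 y; have := Re0 ('i%C *: y); rewrite hipZl phiZ -mulrBr.
case: (hip y x - phi y) => a b /=; rewrite mul0r sub0r mul1r.
by move=> /eqP; rewrite oppr_eq0 => /eqP -> ->.
Qed.

Lemma bounded_linear_adjoint (f : V -> V) : linear f ->
  (exists k : K, forall x, hn (f x) <= k * hn x) ->
  exists g, forall x y, hip (f x) y = hip x (g y).
Proof.
move=> fl /bound_nonneg[k k0 fk].
have /choice[g Hg] y : exists z, forall x, hip (f x) y = hip x z.
  apply: Riesz_representation => [c a b|]; first by rewrite fl hip_linear.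
  exists (k * hn y) => x; apply: le_trans (hip_Cauchy_Schwarz _ _) _.
  by rewrite mulrAC ler_wpM2r ?hn_ge0.
by exists g.
Qed.

End Riesz.

(** * Hilbert spaces of type [hilbertType] *)

Section HilbertHspace.
Context {K : realType} (H : hilbertType K[i]).
Local Notation C := K[i].
Implicit Types x y z : H.

Let inner_linear (c : C) x y z : inner (c *: x + y) z = c * inner x z + inner y z.
Proof. by rewrite linearPl. Qed.

Let inner_conj x y : inner y x = (inner x y)^*.
Proof. by rewrite hermC expr0 mul1r. Qed.

Let inner_ge0 x : 0 <= inner x x.
Proof. by rewrite inner_norm exprn_ge0. Qed.

Let inner_eq0 x : inner x x = 0 -> x = 0.
Proof. by rewrite inner_norm => /eqP; rewrite expf_eq0 normr_eq0 => /eqP. Qed.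

Let norm_lt x (e : K) : 0 < e -> (`|x| < e%:C) = (Re (inner x x) < e ^+ 2).
Proof.
move=> e0; rewrite -[RHS]ltcR -ger0_ReE // inner_norm rmorphXn.
by rewrite ltr_sqr ?nnegrE // ler0c ltW.
Qed.

Let inner_complete (u : nat -> H) :
  (forall e : K, 0 < e -> exists N, forall m n, (N <= m)%N -> (N <= n)%N ->
     Re (inner (u m - u n) (u m - u n)) < e) ->
  exists x, forall e : K, 0 < e -> exists N, forall n, (N <= n)%N ->
     Re (inner (u n - x) (u n - x)) < e.
Proof.
move=> uc; have : cvg (u @ \oo).
  apply: cauchy_cvg; apply/cauchyP => _ /gt0_complexP[e e0 ->].
  have [|N HN] := uc (e ^+ 2); first exact: exprn_gt0.
  exists (u N), N => // n /= Nn.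
  by rewrite -ball_normE /= norm_lt //; exact: HN.
move=> /cvgrPdist_lt ux; exists (lim (u @ \oo)) => e e0.
have s0 : 0 < Num.sqrt e by rewrite sqrtr_gt0.
have [|N _ HN] := ux (Num.sqrt e)%:C; first by rewrite ltcR.
exists N => n /HN /=; rewrite distrC norm_lt // sqr_sqrtr //.
exact: ltW.
Qed.

Definition hilbert_hspace (x : H) (x0 : x != 0) : hspace K :=
  Hspace inner_linear inner_conj inner_ge0 inner_eq0 inner_complete x0.

Section Nonzero.
Context {e : H} (e0 : e != 0).
Let V := hilbert_hspace e0.

Lemma norm_hn (x : V) : `|x : H| = (hn x)%:C.
Proof.
apply/eqP; rewrite -(@eqrXn2 _ 2) ?normr_ge0 ?ler0c ?hn_ge0 // -rmorphXn.
by rewrite -inner_norm; exact/eqP/(hip_hn x).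
Qed.

Lemma adj_bop (X : bop V) : adj (bfun X : H -> H) = bfun (star X).
Proof.
rewrite /adj; case: xgetP => [S _ HS|/(_ (bfun (star X)))[]].
  apply/funext => y; apply: (@hip_ext _ V) => z.
  rewrite (hip_conj (h := V)) [RHS](hip_conj (h := V)); congr (_^*).
  by rewrite -(bop_starE X); exact/esym/HS.
by move=> x y; exact: (bop_starE X).
Qed.

Lemma bounded_opP (f : H -> H) :
  bounded_op f <-> exists X : bop V, f = bfun X.
Proof.
split.
  move=> [fl [k fk]]; have fb : exists k : K, forall x : V, hn (f x : V) <= k * hn x.
    exists (Re k) => x; have := fk x; rewrite !norm_hn.
    by rewrite lecE => /andP[_] /=; rewrite mulrC ReM_real mulrC.
  have fa := bounded_linear_adjoint (V := V) fl fb.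
  by exists (Bop fa fb).
move=> [X ->]; split; first by move=> c x y; exact: (bop_linear X).
have [k Xk] := bfun_bounded X; exists k%:C => x.
by rewrite !norm_hn -rmorphM lecR.
Qed.

End Nonzero.
End HilbertHspace.

(** * Square-summable families *)

Section UnconditionalSums.
Context {K : realType} {X : eqType}.
Local Notation C := K[i].
Implicit Types (f g : X -> C) (F G : seq X).

(** Convergence along the net of finite subsets, coded by duplicate-free lists: no enumeration of X
    is chosen, which makes reindexing along injections direct. *)
Definition has_sum f (s : C) := forall e : K, 0 < e ->
  exists F0 : seq X, forall F, uniq F -> {subset F0 <= F} ->
    cmod (\sum_(x <- F) f x - s) <= e.

Lemma has_sum_unique f s t : has_sum f s -> has_sum f t -> s = t.
Proof.
move=> fs ft; apply/subr0_eq/complex_small => e e0.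
have e2 : 0 < e / 2 by lra.
have [F0 H0] := fs _ e2; have [F1 H1] := ft _ e2.
pose F := undup (F0 ++ F1).
have := H0 F (undup_uniq _) _; have := H1 F (undup_uniq _) _.
have s0 : {subset F0 <= F} by move=> x xF; rewrite mem_undup mem_cat xF.
have s1 : {subset F1 <= F} by move=> x xF; rewrite mem_undup mem_cat xF orbT.
move=> /(_ s1) h1 /(_ s0); rewrite cmodB => h0.
have := cmodD (s - \sum_(x <- F) f x) (\sum_(x <- F) f x - t); rewrite subrKA.
by lra.
Qed.

Lemma has_sumP f g s t (c : C) : has_sum f s -> has_sum g t ->
  has_sum (fun x => c * f x + g x) (c * s + t).
Proof.
move=> fs gt e e0; have k0 : 0 < cmod c + 1 by have := cmod_ge0 c; lra.
have [|F0 H0] := fs (e / (cmod c + 1)); first exact: divr_gt0.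
have [|F1 H1] := gt (e / (cmod c + 1)); first exact: divr_gt0.
exists (F0 ++ F1) => F uF sF.
have s0 : {subset F0 <= F} by move=> x xF; apply: sF; rewrite mem_cat xF.
have s1 : {subset F1 <= F} by move=> x xF; apply: sF; rewrite mem_cat xF orbT.
have := H0 F uF s0; have := H1 F uF s1; rewrite !ler_pdivlMr // => h1 h0.
rewrite big_split /= -mulr_sumr opprD addrACA -mulrBr.
have := cmodD (c * (\sum_(x <- F) f x - s)) (\sum_(x <- F) g x - t).
rewrite cmodM => h; apply: le_trans h _; rewrite -(ler_pM2r k0).
move: h0 h1 (cmod_ge0 c); move: (cmod c) (cmod (_ - s)) (cmod (_ - t)) => r p q h0 h1 r0.
by have := ler_wpM2l r0 h0; lra.
Qed.

Lemma has_sum_conj f s : has_sum f s -> has_sum (fun x => (f x)^*) s^*.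
Proof.
move=> fs e /fs[F0 H]; exists F0 => F uF sF.
by rewrite -rmorph_sum -rmorphB cmodC; exact: H.
Qed.

Definition bounded_sums (g : X -> K) :=
  exists B : K, forall F, uniq F -> \sum_(x <- F) g x <= B.

Lemma sum_subset (g : X -> K) F G : (forall x, 0 <= g x) -> uniq F -> uniq G ->
  {subset F <= G} -> \sum_(x <- F) g x <= \sum_(x <- G) g x.
Proof.
move=> g0 uF uG FG; rewrite (bigID (mem F) _ _ (r := G)) /=.
have -> : \sum_(x <- G | x \in F) g x = \sum_(x <- F) g x.
  rewrite -big_filter; apply: perm_big; apply: uniq_perm; rewrite ?filter_uniq //.
  by move=> x; rewrite mem_filter; case: (boolP (x \in F)) => // /FG ->.
by rewrite lerDl sumr_ge0.
Qed.

Lemma bounded_sums_has_sum (g : X -> K) : (forall x, 0 <= g x) -> bounded_sums g ->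
  exists s : K, has_sum (fun x => (g x)%:C) s%:C.
Proof.
move=> g0 [B HB].
pose E := [set \sum_(x <- F) g x | F in [set F | uniq F]].
have Esup : has_sup E.
  by split; [exists 0, [::]; rewrite ?big_nil|exists B => _ [F uF <-]; exact: HB].
exists (sup E) => e e0; have [_ [F0 uF0 <-] h] := sup_adherent e0 Esup.
exists F0 => F uF sF; rewrite -rmorph_sum -rmorphB /= cmod_real.
rewrite ler_norml; apply/andP; split.
  have := sum_subset g0 uF0 uF sF. lra.
have : \sum_(x <- F) g x <= sup E by apply: ub_le_sup; [case: Esup|exists F].
lra.
Qed.

(** For the real and the imaginary part h, both h + g and g are nonnegative with bounded sums;
    subtract. *)
Lemma dominated_has_sum f (g : X -> K) : (forall x, cmod (f x) <= g x) ->
  bounded_sums g -> exists s, has_sum f s.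
Proof.
move=> fg gB; have g0 x : 0 <= g x by apply: le_trans (fg x); exact: cmod_ge0.
have part (h : X -> K) : (forall x, `|h x| <= g x) ->
    exists s, has_sum (fun x => (h x)%:C) s.
  move=> hg; have h0 x : 0 <= h x + g x.
    by have := hg x; rewrite ler_norml => /andP[]; lra.
  have [s Hs] : exists s : K, has_sum (fun x => (h x + g x)%:C) s%:C.
    apply: bounded_sums_has_sum => //; have [B HB] := gB; exists (B + B) => F uF.
    apply: le_trans (_ : \sum_(x <- F) (g x + g x) <= _).
      by apply: ler_sum => x _; have := ler_norm (h x); have := hg x; lra.
    by rewrite big_split lerD ?HB.
  have [t Ht] := bounded_sums_has_sum g0 gB.
  exists (-1 * t%:C + s%:C); have := has_sumP (-1) Ht Hs.
  congr has_sum; apply/funext => x; rewrite rmorphD /=; ring.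
have [s Hs] := part (fun x => Re (f x)) (fun x => le_trans (ler_Re_cmod _) (fg x)).
have [t Ht] := part (fun x => Im (f x)) (fun x => le_trans (ler_Im_cmod _) (fg x)).
exists ('i%C * t + s); have := has_sumP 'i%C Ht Hs.
by congr has_sum; apply/funext => x; rewrite addrC -complexE.
Qed.

Lemma has_sum_ge (g : X -> K) (s : C) F : (forall x, 0 <= g x) -> uniq F ->
  has_sum (fun x => (g x)%:C) s -> \sum_(x <- F) g x <= Re s.
Proof.
move=> g0 uF Hs; apply/ler_addgt0Pr => e /Hs[F0 H].
pose G := undup (F0 ++ F).
have s0 : {subset F0 <= G} by move=> x xF; rewrite mem_undup mem_cat xF.
have s1 : {subset F <= G} by move=> x xF; rewrite mem_undup mem_cat xF orbT.
have := H G (undup_uniq _) s0.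
rewrite -rmorph_sum => /(le_trans (ler_Re_cmod _)) /(le_trans (ler_norm _)).
have := sum_subset g0 uF (undup_uniq _) s1; rewrite -/G.
by case: s {Hs H} => a b /=; lra.
Qed.

Lemma has_sum_le (g : X -> K) (s : C) (B : K) :
  (forall F, uniq F -> \sum_(x <- F) g x <= B) ->
  has_sum (fun x => (g x)%:C) s -> Re s <= B.
Proof.
move=> gB Hs; apply/ler_addgt0Pr => e /Hs[F0 H].
have := H (undup F0) (undup_uniq _) (fun x => _).
rewrite -rmorph_sum cmodB => /(_ (fun x => etrans (mem_undup _ _))).
move=> /(le_trans (ler_Re_cmod _)) /(le_trans (ler_norm _)).
by have := gB _ (undup_uniq F0); case: s {Hs H} => a b /=; lra.
Qed.

(** Since f vanishes off the range of h, a finite sum of f over F is the sum of f \o h over the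
    preimage of F, computed by [pmap k F]. *)
Lemma has_sum_reindex f s (h : X -> X) (k : X -> option X) : pcancel h k ->
  (forall x, k x = None -> f x = 0) -> (forall x y, k x = Some y -> h y = x) ->
  has_sum (f \o h) s -> has_sum f s.
Proof.
move=> hk k0 kh Hs e /Hs[F0 H]; exists (map h F0) => F uF sF.
have kK : ocancel k h by move=> x; case E : (k x) => [y|] //=; exact: kh.
have uP : uniq (pmap k F) by exact: (pmap_uniq kK).
have -> : \sum_(x <- F) f x = \sum_(x <- pmap k F) (f \o h) x.
  elim: F {uF sF uP} => [|x F IH]; first by rewrite !big_nil.
  rewrite big_cons IH /=; case E : (k x) => [y|] /=.
    by rewrite big_cons /= (kh _ _ E).
  by rewrite k0 // add0r.
apply: H => // x xF; rewrite mem_pmap; apply/mapP; exists (h x); last by rewrite hk.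
by apply: sF; exact: map_f.
Qed.

End UnconditionalSums.

(** * The Hilbert space l^2(X) *)

Record ell2 (K : realType) (X : eqType) := Ell2 {
  ell2_fun :> X -> K[i];
  ell2_bounded : bounded_sums (fun x => cmod (ell2_fun x) ^+ 2)
}.

Section Ell2.
Context {K : realType} {X : eqType}.
Local Notation C := K[i].
Implicit Types (f g h : ell2 K X) (c : C) (x : X).

Lemma ell2P f g : (forall x, f x = g x) -> f = g.
Proof.
move=> /funext; case: f => f f2; case: g => g g2 /= fg.
by rewrite {}fg in f2 *; congr Ell2; exact: Prop_irrelevance.
Qed.

Lemma cmod_sqrD (a b : C) : cmod (a + b) ^+ 2 <= 2 * cmod a ^+ 2 + 2 * cmod b ^+ 2.
Proof.
have h := cmodD a b; have h0 := cmod_ge0 (a + b).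
apply: (le_trans (y := (cmod a + cmod b) ^+ 2)).
  by rewrite ler_sqr ?nnegrE ?addr_ge0 ?cmod_ge0.
by have := sqr_ge0 (cmod a - cmod b); rewrite sqrrB sqrrD; lra.
Qed.

Let lin_bounded c f g : bounded_sums (fun x => cmod (c * f x + g x) ^+ 2).
Proof.
have [A HA] := ell2_bounded f; have [B HB] := ell2_bounded g.
exists (2 * cmod c ^+ 2 * A + 2 * B) => F uF.
apply: (le_trans (y := \sum_(x <- F)
    (2 * cmod c ^+ 2 * cmod (f x) ^+ 2 + 2 * cmod (g x) ^+ 2))).
  apply: ler_sum => x _; apply: le_trans (cmod_sqrD _ _) _.
  by rewrite cmodM exprMn mulrA.
rewrite big_split /= -!mulr_sumr lerD // ler_wpM2l ?HA ?HB //.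
by rewrite mulr_ge0 ?sqr_ge0.
Qed.

Let zero_bounded : bounded_sums (fun x : X => cmod (0 : C) ^+ 2).
Proof. by exists 0 => F _; rewrite big1 // => x _; rewrite cmod0 expr0n. Qed.

Definition ell2_lin c f g := Ell2 (lin_bounded c f g).
Definition ell2_zero := Ell2 zero_bounded.
Definition ell2_add f g := ell2_lin 1 f g.
Definition ell2_opp f := ell2_lin (-1) f ell2_zero.
Definition ell2_scale c f := ell2_lin c f ell2_zero.

HB.instance Definition _ := gen_eqMixin (ell2 K X).
HB.instance Definition _ := gen_choiceMixin (ell2 K X).

Let addA : associative ell2_add.
Proof. by move=> f g h; apply: ell2P => x /=; rewrite !mul1r addrA. Qed.

Let addC : commutative ell2_add.
Proof. by move=> f g; apply: ell2P => x /=; rewrite !mul1r addrC. Qed.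

Let add0 : left_id ell2_zero ell2_add.
Proof. by move=> f; apply: ell2P => x /=; rewrite mul1r add0r. Qed.

Let addN : left_inverse ell2_zero ell2_opp ell2_add.
Proof. by move=> f; apply: ell2P => x /=; rewrite mul1r addr0 mulN1r addNr. Qed.

HB.instance Definition _ := GRing.isZmodule.Build (ell2 K X) addA addC add0 addN.

Let scaleA c (c' : C) f : ell2_scale c (ell2_scale c' f) = ell2_scale (c * c') f.
Proof. by apply: ell2P => x /=; rewrite !addr0 mulrA. Qed.

Let scale1 : left_id 1 ell2_scale.
Proof. by move=> f; apply: ell2P => x /=; rewrite addr0 mul1r. Qed.

Let scaleDr : right_distributive ell2_scale +%R.
Proof. by move=> c f g; apply: ell2P => x /=; rewrite !addr0 !mul1r mulrDr. Qed.

Let scaleDl f : {morph ell2_scale^~ f : a b / a + b}.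
Proof. by move=> a b; apply: ell2P => x /=; rewrite !addr0 mul1r mulrDl. Qed.

HB.instance Definition _ := GRing.Zmodule_isLmodule.Build C (ell2 K X)
  scaleA scale1 scaleDr scaleDl.

Lemma ell2_addE f g x : (f + g) x = f x + g x.
Proof. by rewrite /= mul1r. Qed.

Lemma ell2_scaleE c f x : (c *: f) x = c * f x.
Proof. by rewrite /= addr0. Qed.

Lemma ell2_subE f g x : (f - g) x = f x - g x.
Proof. by rewrite ell2_addE -scaleN1r ell2_scaleE mulN1r. Qed.

Lemma ell2_sumE (I : Type) (r : seq I) (F : I -> ell2 K X) x :
  (\sum_(i <- r) F i) x = \sum_(i <- r) F i x.
Proof.
by apply: (big_morph (fun f : ell2 K X => f x)) => // f g; exact: ell2_addE.
Qed.

Definition ell2_ip f g : C := xget 0 (has_sum (fun x => f x * (g x)^*)).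

Lemma ell2_has_sum f g : has_sum (fun x => f x * (g x)^*) (ell2_ip f g).
Proof.
have [s Hs] : exists s, has_sum (fun x => f x * (g x)^*) s.
  apply: (dominated_has_sum (g := fun x => cmod (f x) ^+ 2 + cmod (g x) ^+ 2)).
    move=> x; rewrite cmodM cmodC; have := sqr_ge0 (cmod (f x) - cmod (g x)).
    rewrite sqrrB; have := sqr_ge0 (cmod (f x)); have := sqr_ge0 (cmod (g x)).
    by have := mulr_ge0 (cmod_ge0 (f x)) (cmod_ge0 (g x)); lra.
  have [A HA] := ell2_bounded f; have [B HB] := ell2_bounded g.
  by exists (A + B) => F uF; rewrite big_split lerD ?HA ?HB.
exact: (xgetPex 0 (ex_intro _ s Hs)).
Qed.

Lemma ell2_ipE f g s : has_sum (fun x => f x * (g x)^*) s -> ell2_ip f g = s.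
Proof. exact: has_sum_unique (ell2_has_sum f g). Qed.

Let ip_linear c f g h : ell2_ip (c *: f + g) h = c * ell2_ip f h + ell2_ip g h.
Proof.
apply: ell2_ipE; have := has_sumP c (ell2_has_sum f h) (ell2_has_sum g h).
congr has_sum; apply/funext => x.
by rewrite ell2_addE ell2_scaleE mulrDl mulrA.
Qed.

Let ip_conj f g : ell2_ip g f = (ell2_ip f g)^*.
Proof.
apply: ell2_ipE; have := has_sum_conj (ell2_has_sum f g).
by congr has_sum; apply/funext => x; rewrite rmorphM /= conjCK mulrC.
Qed.

Lemma ell2_norm_has_sum f :
  has_sum (fun x => (cmod (f x) ^+ 2)%:C) (ell2_ip f f).
Proof.
have := ell2_has_sum f f; congr has_sum; apply/funext => x.
by rewrite cmod_sqr.
Qed.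

Lemma ell2_norm_ge f F : uniq F -> \sum_(x <- F) cmod (f x) ^+ 2 <= Re (ell2_ip f f).
Proof.
by move=> uF; apply: has_sum_ge (ell2_norm_has_sum f) => // x; rewrite sqr_ge0.
Qed.

Lemma ell2_norm_le f (B : K) : (forall F, uniq F -> \sum_(x <- F) cmod (f x) ^+ 2 <= B) ->
  Re (ell2_ip f f) <= B.
Proof. by move=> fB; apply: has_sum_le (ell2_norm_has_sum f). Qed.

Let ip_ge0 f : 0 <= ell2_ip f f.
Proof.
have := ip_conj f f; have := ell2_norm_ge f (erefl : uniq [::]).
rewrite big_nil lecE /=; case: (ell2_ip f f) => a b /= -> [] bb.
by rewrite andbT; apply/eqP; lra.
Qed.

Lemma ell2_coord f x : cmod (f x) ^+ 2 <= Re (ell2_ip f f).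
Proof.
by have := ell2_norm_ge f (erefl : uniq [:: x]); rewrite big_seq1.
Qed.

Let ip_eq0 f : ell2_ip f f = 0 -> f = 0.
Proof.
move=> f0; apply: ell2P => x; apply: cmod0_eq0; apply/eqP.
by rewrite -sqrf_eq0 eq_le sqr_ge0 andbT; have := ell2_coord f x; rewrite f0.
Qed.

Lemma complex_complete (u : nat -> C) :
  (forall e : K, 0 < e -> exists N, forall m n, (N <= m)%N -> (N <= n)%N ->
     cmod (u m - u n) < e) ->
  exists z, forall e : K, 0 < e -> exists N, forall n, (N <= n)%N ->
     cmod (u n - z) < e.
Proof.
move=> uc.
have real (w : nat -> K) : (forall m n, `|w m - w n| <= cmod (u m - u n)) ->
    exists l, forall e : K, 0 < e -> exists N, forall n, (N <= n)%N -> `|w n - l| < e.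
  move=> wu; have : cvg (w @ \oo).
    apply: cauchy_cvg; apply/cauchyP => e e0; have [N HN] := uc _ e0.
    exists (w N), N => // n /= Nn; rewrite -ball_normE /=.
    exact: le_lt_trans (wu _ _) (HN _ _ _ _).
  move=> /cvgrPdist_lt wl; exists (lim (w @ \oo)) => e e0.
  by have [N _ HN] := wl _ e0; exists N => n /HN /=; rewrite distrC.
have [a Ha] : exists l, forall e : K, 0 < e -> exists N, forall n, (N <= n)%N ->
    `|Re (u n) - l| < e.
  apply: real => m n; apply: le_trans (ler_Re_cmod _).
  by case: (u m) (u n) => ? ? [].
have [b Hb] : exists l, forall e : K, 0 < e -> exists N, forall n, (N <= n)%N ->
    `|Im (u n) - l| < e.
  apply: real => m n; apply: le_trans (ler_Im_cmod _).
  by case: (u m) (u n) => ? ? [].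
exists (a +i* b) => e e0; have e2 : 0 < e / 2 by lra.
have [N1 H1] := Ha _ e2; have [N2 H2] := Hb _ e2.
exists (maxn N1 N2) => n; rewrite geq_max => /andP[/H1 h1 /H2 h2].
apply: le_lt_trans (ler_cmod_ReIm _) _; case: (u n) h1 h2 => ? ? /=; lra.
Qed.

Let ip_complete (u : nat -> ell2 K X) :
  (forall e : K, 0 < e -> exists N, forall m n, (N <= m)%N -> (N <= n)%N ->
     Re (ell2_ip (u m - u n) (u m - u n)) < e) ->
  exists f, forall e : K, 0 < e -> exists N, forall n, (N <= n)%N ->
     Re (ell2_ip (u n - f) (u n - f)) < e.
Proof.
move=> uc.
have /choice[l Hl] x : exists z, forall e : K, 0 < e -> exists N,
    forall n, (N <= n)%N -> cmod (u n x - z) < e.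
  apply: complex_complete => e e0; have [|N HN] := uc (e ^+ 2); first exact: exprn_gt0.
  exists N => m n Nm Nn; rewrite -ltr_sqr ?nnegrE ?cmod_ge0 ?(ltW e0) //.
  by rewrite -ell2_subE; apply: le_lt_trans (ell2_coord _ x) (HN _ _ _ _).
have fin (F : seq X) (e : K) : 0 < e -> exists N, forall n, (N <= n)%N ->
    \sum_(x <- F) cmod (u n x - l x) ^+ 2 <= e.
  elim: F e => [|x F IH] e e0; first by exists 0%N => n _; rewrite big_nil ltW.
  have e2 : 0 < e / 2 by lra.
  have [N1 H1] := IH _ e2; have [|N2 H2] := Hl x (Num.sqrt (e / 2)).
    by rewrite sqrtr_gt0.
  exists (maxn N1 N2) => n; rewrite geq_max => /andP[/H1 h1 /H2].
  rewrite big_cons -ltr_sqr ?nnegrE ?cmod_ge0 ?sqrtr_ge0 // (sqr_sqrtr (ltW e2)).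
  by move: h1; lra.
(* The point is that N is independent of F. For given F, u n is compared with some u m, m depending
   on F, and (a + b)^2 <= 2a^2 + 2b^2 turns two bounds e/4 into e. *)
have unif (e : K) : 0 < e -> exists N, forall n, (N <= n)%N -> forall F, uniq F ->
    \sum_(x <- F) cmod (u n x - l x) ^+ 2 <= e.
  move=> e0; have e4 : 0 < e / 4 by lra.
  have [N HN] := uc _ e4; exists N => n Nn F uF.
  have [N' HN'] := fin F _ e4; set m := maxn N N'.
  have := HN' m (leq_maxr _ _); have := HN n m Nn (leq_maxl _ _).
  have := ell2_norm_ge (u n - u m) uF => h1 h2 h3.
  apply: (le_trans (y := \sum_(x <- F) (2 * cmod ((u n - u m) x) ^+ 2
      + 2 * cmod (u m x - l x) ^+ 2))).
    apply: ler_sum => x _; apply: le_trans (cmod_sqrD _ _).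
    by rewrite ell2_subE subrKA.
  rewrite [leLHS](_ : _ = 2 * \sum_(x <- F) cmod ((u n - u m) x) ^+ 2
      + 2 * \sum_(x <- F) cmod (u m x - l x) ^+ 2); first by lra.
  by rewrite big_split !mulr_sumr.
have lb : bounded_sums (fun x => cmod (l x) ^+ 2).
  have [N /(_ _ (leqnn N)) HN] := unif 1 ltr01.
  exists (2 * Re (ell2_ip (u N) (u N)) + 2 * 1) => F uF.
  apply: (le_trans (y := \sum_(x <- F) (2 * cmod (u N x) ^+ 2
      + 2 * cmod (u N x - l x) ^+ 2))).
    apply: ler_sum => x _; rewrite (cmodB (u N x)); apply: le_trans (cmod_sqrD _ _).
    by rewrite addrC subrK.
  rewrite big_split /= -!mulr_sumr lerD // ler_pM2l //; last exact: HN.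
  exact: ell2_norm_ge.
exists (Ell2 lb) => e e0; have e2 : 0 < e / 2 by lra.
have [N HN] := unif _ e2; exists N => n Nn.
apply: (le_lt_trans (y := e / 2)); last by lra.
apply: ell2_norm_le => F uF; under eq_bigr do rewrite ell2_subE.
exact: HN.
Qed.

Let delta_bounded x : bounded_sums (fun y => cmod ((y == x)%:R : C) ^+ 2).
Proof.
exists 1 => F uF; apply: (le_trans (y := \sum_(y <- F) (y == x)%:R)).
  by apply: ler_sum => y _; case: eqP; rewrite ?cmod1 ?cmod0 ?expr1n ?expr0n.
have [xF|xF] := boolP (x \in F).
  rewrite (bigD1_seq x) //= eqxx big1 ?addr0 // => y /negbTE -> //.
rewrite big_seq big1 // => y yF; case: eqP => // yx.
by rewrite -yx yF in xF.
Qed.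

Definition ell2_delta x := Ell2 (delta_bounded x).

Let delta_neq0 x : ell2_delta x != 0.
Proof.
apply/eqP => /(congr1 (fun f => ell2_fun f x)) /=; rewrite eqxx => /eqP.
by rewrite oner_eq0.
Qed.

Lemma ell2_delta_unit x : ell2_ip (ell2_delta x) (ell2_delta x) = 1.
Proof.
apply: ell2_ipE => e e0; exists [:: x] => F uF /(_ x (mem_head _ _)) xF.
rewrite (bigD1_seq x) //= eqxx big1 => [|y /negbTE yx]; last by rewrite yx mul0r.
by rewrite !mulr1n rmorph1 mulr1 addr0 subrr cmod0 ltW.
Qed.

Definition ell2_hspace x : hspace K :=
  Hspace ip_linear ip_conj ip_ge0 ip_eq0 ip_complete (delta_neq0 x).

End Ell2.

(** * Existence of the embezzling state *)

Section UltraLimit.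
Context {K : realType} (U : set_system nat) {UU : UltraFilter U}.
Local Notation C := K[i].
Implicit Types (z w : nat -> C) (l m : C).

Definition ulim z l := forall e : K, 0 < e -> U [set n | cmod (z n - l) <= e].

Lemma ulim_unique z l m : ulim z l -> ulim z m -> l = m.
Proof.
move=> zl zm; apply/subr0_eq/complex_small => e e0; have e2 : 0 < e / 2 by lra.
have [n [/= h1 h2]] := @filter_ex _ U _ _ (filterI (zl _ e2) (zm _ e2)).
have := cmodD (l - z n) (z n - m); rewrite subrKA (cmodB l).
by lra.
Qed.

Lemma ulimP z w l m (c : C) : ulim z l -> ulim w m ->
  ulim (fun n => c * z n + w n) (c * l + m).
Proof.
move=> zl wm e e0; have k0 : 0 < cmod c + 1 by have := cmod_ge0 c; lra.
have ek : 0 < e / (cmod c + 1) by exact: divr_gt0.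
apply: filterS (filterI (zl _ ek) (wm _ ek)) => n [/=]; rewrite !ler_pdivlMr //.
move=> h1 h2; rewrite opprD addrACA -mulrBr.
have := cmodD (c * (z n - l)) (w n - m); rewrite cmodM => h.
apply: le_trans h _; rewrite -(ler_pM2r k0).
move: h1 h2 (cmod_ge0 c); move: (cmod c) (cmod (_ - l)) (cmod (_ - m)) => r p q h0 h1 r0.
by have := ler_wpM2l r0 h0; lra.
Qed.

Lemma ulim_ge0 z l : (forall n, 0 <= z n) -> ulim z l -> 0 <= l.
Proof.
move=> z0 zl; have h e : 0 < e -> `|Im l| <= e /\ 0 <= Re l + e.
  move=> e0; have [n /= hn] := @filter_ex _ U _ _ (zl _ e0).
  have := ger0_Im (z0 n); have := z0 n; rewrite (ger0_ReE (z0 n)) ler0c => r0 _.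
  have := le_trans (ler_Im_cmod _) hn; have := le_trans (ler_Re_cmod _) hn.
  rewrite (ger0_ReE (z0 n)); case: l {zl hn} => a b /=.
  rewrite sub0r normrN => /(le_trans (ler_norm _)) h1 h2; split => //; lra.
rewrite lecE /=; apply/andP; split.
  rewrite -normr_eq0 eq_le normr_ge0 andbT.
  by apply/ler_addgt0Pr => e /h[]; rewrite add0r.
by apply/ler_addgt0Pr => e /h[].
Qed.

Lemma ulim_exists z (B : K) : (forall n, cmod (z n) <= B) -> exists l, ulim z l.
Proof.
move=> zB.
have real (w : nat -> K) : (forall n, `|w n| <= B) ->
    exists l : K, forall e : K, 0 < e -> U [set n | `|w n - l| < e].
  move=> wB.
  have wBB : (w @ U) `[- B, B]%classic.
    rewrite /fmap /=; apply: (@filterS _ U _ setT) filterT => n _ /=.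
    by rewrite in_itv /=; have := wB n; rewrite ler_norml.
  have [l [_ wl]] := segment_compact (fmap_proper_filter w _) wBB.
  (* Here l is a cluster point given by compactness of [-B, B]. Were the set outside U, its
     complement would be in U, and the image of that complement would meet the ball around l. *)
  exists l => e e0; have [//|Uc] := in_ultra_setVsetC [set n | `|w n - l| < e] UU.
  have [|_ [[n /= hn <-]]] :=
      wl (w @` ~` [set n | `|w n - l| < e]) (ball l e) _ (nbhsx_ballx _ _ e0).
    by rewrite /fmap /=; apply: (@filterS _ U _ _ _ _ Uc) => n hn; exists n.
  by rewrite -ball_normE /= distrC.
have [a Ha] : exists l : K, forall e : K, 0 < e -> U [set n | `|Re (z n) - l| < e].
  by apply: real => n; exact: le_trans (ler_Re_cmod _) (zB n).
have [b Hb] : exists l : K, forall e : K, 0 < e -> U [set n | `|Im (z n) - l| < e].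
  by apply: real => n; exact: le_trans (ler_Im_cmod _) (zB n).
exists (a +i* b) => e e0; have e2 : 0 < e / 2 by lra.
apply: filterS (filterI (Ha _ e2) (Hb _ e2)) => n [/= h1 h2].
apply: le_trans (ler_cmod_ReIm _) _; case: (z n) h1 h2 => ? ? /=; lra.
Qed.

End UltraLimit.

(** Weak-* compactness of the state space: an ultrafilter refining the eventual filter gives all the
    limits s_n(a) at once, by the bound |a|, and agrees with ordinary limits where these exist. *)
Lemma state_limit (K : realType) (A : cstarAlgType K[i]) (s_ : nat -> A -> K[i]) :
  (forall n, is_state (s_ n)) ->
  exists2 s : A -> K[i], is_state s & forall a (c : K[i]),
    (forall e : K, 0 < e -> exists N, forall n, (N <= n)%N ->
       cmod (s_ n a - c) <= e) -> s a = c.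
Proof.
move=> ss; have [U [UU Uoo]] := ultraFilterLemma eventually_filter.
have /choice[s Hs] a : exists l, ulim U (s_ ^~ a) l.
  by apply: (ulim_exists (B := rnorm a)) => n; exact: state_rnorm.
have cst (c : K[i]) : ulim U (fun=> c) c.
  by move=> e e0; apply: filterS filterT => n _ /=; rewrite subrr cmod0 ltW.
exists s => [|a c ac]; last first.
  apply: ulim_unique (Hs a) _ => e /ac[N HN]; apply: Uoo; exists N => //.
split.
- move=> c a b; apply: ulim_unique (Hs _) _.
  rewrite (_ : s_ ^~ _ = fun n => c * s_ n a + s_ n b); first exact: ulimP.
  by apply/funext => n; rewrite (stateD (ss n)) (stateZ (ss n)).
- by move=> a; apply: ulim_ge0 (Hs _) => n; case: (ss n).
- apply: ulim_unique (Hs _) _; rewrite (_ : s_ ^~ _ = fun=> 1) //.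
  by apply/funext => n; case: (ss n).
Qed.

(** * Isometries of l^2(X) induced by injections of X *)

Record shift_data (X : Type) := ShiftData {
  sh : X -> X;
  sk : X -> option X;
  shK : pcancel sh sk;
  skK : forall x y, sk x = Some y -> sh y = x
}.

Section ShiftOperators.
Context {K : realType} {X : eqType} (x0 : X).
Local Notation C := K[i].
Local Notation V := (@ell2_hspace K X x0).
Implicit Types (f g : V) (s : shift_data X).

Let pull_bounded s (f : ell2 K X) : bounded_sums (fun x => cmod (f (sh s x)) ^+ 2).
Proof.
have [B HB] := ell2_bounded f; exists B => F uF.
rewrite -(big_map (sh s) predT (fun y => cmod (f y) ^+ 2)).
by apply: HB; rewrite map_inj_uniq //; exact: pcan_inj (shK s).
Qed.

Let push_bounded s (f : ell2 K X) : bounded_sums (fun x => cmod (oapp f 0 (sk s x)) ^+ 2).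
Proof.
have [B HB] := ell2_bounded f; exists B => F uF.
have kK : ocancel (sk s) (sh s).
  by move=> x; case E : (sk s x) => [y|] //=; exact: skK.
apply: le_trans (HB _ (pmap_uniq kK uF)).
elim: F {uF} => [|x F IH]; first by rewrite !big_nil.
rewrite big_cons /=; case E : (sk s x) => [y|] /=; first by rewrite big_cons lerD2l.
by rewrite cmod0 expr0n add0r.
Qed.

(** [push] is the isometry sending the delta at x to the delta at [sh s x], with default value 0 off
    the range; [pull] is its adjoint. *)
Definition pull s f : V := Ell2 (pull_bounded s f).
Definition push s f : V := Ell2 (push_bounded s f).

Lemma push_pull s f g : hip (push s f) g = hip f (pull s g).
Proof.
apply: ell2_ipE; apply: (has_sum_reindex (shK s)); last 1 first.
- have := ell2_has_sum f (pull s g); congr has_sum; apply/funext => x /=.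
  by rewrite shK.
- by move=> x /= ->; rewrite mul0r.
- exact: skK.
Qed.

Lemma pull_push s f : pull s (push s f) = f.
Proof. by apply: ell2P => x /=; rewrite shK. Qed.

Definition shift_op s : bop V.
Proof.
apply: (@Bop _ _ (push s)); first by exists (pull s) => f g; exact: push_pull.
by exists 1 => f; rewrite mul1r /hn push_pull pull_push.
Defined.

Lemma shift_opE s f x : shift_op s f x = oapp f 0 (sk s x).
Proof. by []. Qed.

Lemma shift_op_starE s f x : star (shift_op s) f x = f (sh s x).
Proof.
suff -> : star (shift_op s) f = pull s f by [].
by apply: hip_ext => g; rewrite (hip_conj g) -bop_starE push_pull -hip_conj.
Qed.

End ShiftOperators.

(** * Commuting Cuntz isometries from base d digits *)

Section CuntzShifts.
Context {K : realType} {d : nat} (hd : (2 <= d)%N).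
Local Notation C := K[i].
Local Notation X := (nat * nat)%type.
Local Notation V := (@ell2_hspace K X (0%N, 0%N)).

Let d0 : (0 < d)%N. Proof. exact: ltnW. Qed.

(** Partial inverse of n |-> n d + i: it removes the last digit if that digit is i. *)
Let divk (i : 'I_d) n : option nat := if (n %% d == i)%N then Some (n %/ d)%N else None.

Let divkK i n m : divk i n = Some m -> (m * d + i)%N = n.
Proof. by rewrite /divk; case: eqP => // <- [<-]; rewrite -divn_eq. Qed.

Let divk_mul (i j : 'I_d) n : divk j (n * d + i)%N = if i == j then Some n else None.
Proof.
rewrite /divk modnMDl modn_small //.
rewrite divnMDl // divn_small // addn0.
by rewrite (inj_eq val_inj).
Qed.

Let digitl_K (i : 'I_d) : pcancel (fun p : X => (p.1 * d + i, p.2)%N)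
  (fun p => omap (fun m => (m, p.2)) (divk i p.1)).
Proof. by case=> m n /=; rewrite divk_mul eqxx. Qed.

Let digitl_kK (i : 'I_d) (p q : X) : omap (fun m => (m, p.2)) (divk i p.1) = Some q ->
  (q.1 * d + i, q.2)%N = p.
Proof.
by case: p => m n /=; case E : (divk i m) => [l|] //= [<-] /=; rewrite (divkK E).
Qed.

Let digitr_K (i : 'I_d) : pcancel (fun p : X => (p.1, p.2 * d + i)%N)
  (fun p => omap (fun m => (p.1, m)) (divk i p.2)).
Proof. by case=> m n /=; rewrite divk_mul eqxx. Qed.

Let digitr_kK (i : 'I_d) (p q : X) : omap (fun m => (p.1, m)) (divk i p.2) = Some q ->
  (q.1, q.2 * d + i)%N = p.
Proof.
by case: p => m n /=; case E : (divk i n) => [l|] //= [<-] /=; rewrite (divkK E).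
Qed.

Definition shiftl (i : 'I_d) : bop V := shift_op _ (ShiftData (digitl_K i) (@digitl_kK i)).
Definition shiftr (i : 'I_d) : bop V := shift_op _ (ShiftData (digitr_K i) (@digitr_kK i)).

Let bop_ell2P (A B : bop V) : (forall (f : V) x, A f x = B f x) -> A = B.
Proof. by move=> AB; apply: bopP => f; apply: ell2P => x; exact: AB. Qed.

Lemma shiftl_orth i j : star (shiftl i) * shiftl j = (i == j)%:R.
Proof.
apply: bop_ell2P => f [m n]; rewrite bop_mulE shift_op_starE shift_opE /= divk_mul.
by case: eqP.
Qed.

Lemma shiftr_orth i j : star (shiftr i) * shiftr j = (i == j)%:R.
Proof.
apply: bop_ell2P => f [m n]; rewrite bop_mulE shift_op_starE shift_opE /= divk_mul.
by case: eqP.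
Qed.

Let divk_sum (F : nat -> 'I_d -> C) n : \sum_i oapp (F^~ i) 0 (divk i n) =
  F (n %/ d)%N (Ordinal (ltn_pmod n d0)).
Proof.
rewrite (bigD1 (Ordinal (ltn_pmod n d0))) //= /divk eqxx big1 ?addr0 // => i.
by rewrite -(inj_eq val_inj) /= eq_sym => /negbTE ->.
Qed.

(** The ranges partition N x N by the last digit of one coordinate, so the range projections add up
    to 1; the families commute because they act on different coordinates. *)
Lemma shifts_commuting : commuting_isometries shiftl shiftr.
Proof.
split.
- split=> [i|]; first by rewrite shiftl_orth eqxx.
  apply: bop_ell2P => f [m n]; rewrite bop_sumE ell2_sumE.
  transitivity (\sum_(i < d) oapp (fun m' => f (m' * d + i, n)%N) 0 (divk i m)).
    apply: eq_bigr => i _; rewrite bop_mulE shift_opE /=; case: (divk i m) => //= l.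
    by rewrite shift_op_starE.
  by rewrite (divk_sum (fun m' (i : 'I_d) => f (m' * d + i, n)%N)) /= -divn_eq.
- split=> [i|]; first by rewrite shiftr_orth eqxx.
  apply: bop_ell2P => f [m n]; rewrite bop_sumE ell2_sumE.
  transitivity (\sum_(i < d) oapp (fun n' => f (m, n' * d + i)%N) 0 (divk i n)).
    apply: eq_bigr => i _; rewrite bop_mulE shift_opE /=; case: (divk i n) => //= l.
    by rewrite shift_op_starE.
  by rewrite (divk_sum (fun n' (i : 'I_d) => f (m, n' * d + i)%N)) /= -divn_eq.
- move=> i j; apply: bop_ell2P => f [m n] /=.
  by case E : (divk i m) => [l|]; case F : (divk j n) => [u|] /=; rewrite ?E ?F.
- move=> i j; apply: bop_ell2P => f [m n].
  rewrite bop_mulE shift_op_starE shift_opE /=.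
  by case: (divk j n) => //= l; rewrite shift_op_starE.
Qed.

End CuntzShifts.

(** * Universal property of the tensor product on generators *)

Section CuntzTensor.
Context {K : realType} {d : nat} {O T : cstarAlgType K[i]}.
Context {v : 'I_d -> O} {iL iR : O -> T}.
Local Notation C := K[i].
Hypotheses (HO : is_cuntz_algebra v) (HT : is_max_tensor iL iR).

(** Generation is used twice: to pass from the generators to all a against a fixed g(v_j), then to
    all b against a fixed f(a). *)
Lemma star_hom_commute (D : cstarAlgType C) (f g : O -> D) :
  star_hom f -> star_hom g ->
  (forall i j, f (v i) * g (v j) = g (v j) * f (v i)) ->
  (forall i j, star (f (v i)) * g (v j) = g (v j) * star (f (v i))) ->
  forall a b, f a * g b = g b * f a.
Proof.
move=> fh gh fg fsg; have [_ vgen _] := HO.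
have full (N : set O) : cstar_subalgebra N -> (forall i, N (v i)) -> forall a, N a.
  by move=> Nsub Nv a; rewrite (vgen _ Nsub) // => _ [i _ <-].
have fgv a j : f a * g (v j) = g (v j) * f a.
  have [] // := full _ (cstar_subalgebra_commute (g (v j)) fh) _ a => i.
  split; first exact: fg.
  by apply: (inv_inj starK); rewrite !starM !starK fsg.
move=> a b; have [] // := full _ (cstar_subalgebra_commute (f a) gh) _ b => j.
case: (fh) => _ _ _ fs; split; first by rewrite fgv.
by rewrite -fs fgv.
Qed.

Lemma cuntz_tensor_isometries :
  commuting_isometries (iL \o v) (iR \o v).
Proof.
have [[vv v1] _ _] := HO; have [Lh Rh LR _ _] := HT.
have image (f : O -> T) : star_hom f -> cuntz_isometries (f \o v).
  move=> fh; have [fl fM f1 fs] := fh; split=> [i|] /=.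
    by rewrite -fs -fM vv.
  rewrite -f1 -v1 (big_morph f (star_homD fh) (star_hom0 fh)).
  by apply: eq_bigr => i _; rewrite fM fs.
split; [exact: image|exact: image|by move=> i j; exact: LR|].
by move=> i j /=; have [_ _ _ <-] := Lh; exact: LR.
Qed.

Lemma cuntz_tensor_hom (D : cstarAlgType C) (V W : 'I_d -> D) :
  commuting_isometries V W -> exists h : T -> D,
    [/\ star_hom h, forall i, h (iL (v i)) = V i & forall j, h (iR (v j)) = W j].
Proof.
move=> [Vc Wc VW VsW]; have [_ _ univ] := HO; have [_ _ _ _ Tuniv] := HT.
have [f [fh fv]] := univ D V Vc; have [g [gh gv]] := univ D W Wc.
have [|h [hh hL hR]] := Tuniv D f g fh gh.
  by apply: star_hom_commute => // i j; rewrite fv gv ?VW ?VsW.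
by exists h; split => // i; rewrite ?hL ?hR.
Qed.

End CuntzTensor.

(** * Approximate fixed vectors of Phi *)

Section ApproximateEmbezzlement.
Context {K : realType} {d : nat} {alpha : 'I_d -> K} {V : hspace K}.
Local Notation C := K[i].
Context {v w : 'I_d -> bop V} {psi : V}.
Hypotheses (alpha_norm : \sum_i alpha i ^+ 2 = 1)
  (v_orth : forall i j, star (v i) * v j = (i == j)%:R)
  (w_orth : forall i j, star (w i) * w j = (i == j)%:R)
  (psi_unit : hip psi psi = 1)
  (psi_wandering : forall i, star (v i * w i) psi = 0).

Let Phi := \sum_i (alpha i)%:C *: (v i * w i).

Lemma star_vw_Phi i j : star (v i * w j) * Phi = ((i == j)%:R * (alpha i)%:C)%:A.
Proof.
rewrite /Phi mulr_sumr (bigD1 i) //= big1 => [|k ki].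
  rewrite addr0 -scalerAr starM -mulrA (mulrA (star (v i))) v_orth eqxx mul1r w_orth.
  rewrite eq_sym; have [_|_] := eqVneq i j; first by rewrite mul1r.
  by rewrite mul0r scaler0 scale0r.
rewrite -scalerAr starM -mulrA (mulrA (star (v i))) v_orth eq_sym (negbTE ki).
by rewrite mul0r mulr0 scaler0.
Qed.

Lemma Phi_isometry : star Phi * Phi = 1.
Proof.
rewrite {1}/Phi star_sum mulr_suml.
transitivity (\sum_i (alpha i ^+ 2)%:C *: (1 : bop V)).
  apply: eq_bigr => i _; rewrite starZ -scalerAl star_vw_Phi eqxx mul1r scalerA.
  by rewrite conjc_realC rmorphXn.
by rewrite -scaler_suml -rmorph_sum alpha_norm scale1r.
Qed.

Lemma hn_Phi x : hn (Phi x) = hn x.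
Proof. by rewrite /hn bop_starE -bop_mulE Phi_isometry. Qed.

Lemma psi_orth_Phi x : hip (Phi x) psi = 0.
Proof.
rewrite bop_starE star_sum bop_sumE big1 ?hip0r // => i _.
by rewrite starZ bop_scaleE psi_wandering scaler0.
Qed.

(* xi is the normalization of psi + Phi psi + ... + Phi^n psi, a sum of n + 1
   orthonormal vectors. *)
Lemma approximate_embezzlement (e : K) : 0 < e ->
  exists xi : V, hip xi xi = 1 /\ hn (Phi xi - xi) <= e.
Proof.
move=> e0; pose x n := iter n (fun y => psi + Phi y) 0.
have xS n : x n.+1 = psi + Phi (x n) by [].
have xn n : hip (x n) (x n) = n%:R.
  elim: n => [|n IH]; first by rewrite hip0l.
  rewrite xS hipDl !hipDr psi_unit psi_orth_Phi (hip_conj (Phi _)) psi_orth_Phi.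
  rewrite rmorph0 addr0 add0r (bop_starE Phi) -bop_mulE Phi_isometry.
  by rewrite bop_oneE IH nat1r.
have hnpsi : hn psi = 1 by rewrite /hn psi_unit sqrtr1.
have dx n : hn (x n.+1 - x n) = 1.
  elim: n => [|n IH]; first by rewrite subr0 xS bop0 addr0.
  by rewrite xS [x n.+1]xS opprD addrACA subrr add0r -bopB hn_Phi.
(* The defect of the unnormalized vector telescopes to Phi^(N+1) psi - psi, of norm at most 2; after
   division by sqrt(N + 1), its squared norm is at most 4/(N + 1). *)
have [|N /(_ N (leqnn N)) HN] := @inv_succ_small K (e ^+ 2 / 4).
  by rewrite divr_gt0 ?exprn_gt0.
pose t := Num.sqrt (N.+1%:R^-1 : K).
have t2 : t ^+ 2 = N.+1%:R^-1 by rewrite sqr_sqrtr ?invr_ge0.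
have t0 : 0 <= t by exact: sqrtr_ge0.
exists (t%:C *: x N.+1); split.
  rewrite hipZl hipZr conjc_realC mulrA xn -rmorphM -expr2 t2.
  rewrite -(rmorph_nat (real_complex K)) -rmorphM mulVf ?rmorph1 //.
  by rewrite pnatr_eq0.
rewrite bopZ -scalerBr hnZ cmod_real ger0_norm //.
have -> : Phi (x N.+1) - x N.+1 = x N.+2 - x N.+1 - psi.
  by rewrite (xS N.+1) addrAC [psi + _]addrC addrK.
have := hnB (x N.+2 - x N.+1) psi; rewrite dx hnpsi => h.
apply: (le_trans (y := t * 2)); first by rewrite ler_wpM2l //; lra.
rewrite -ler_sqr ?nnegrE ?(ltW e0) ?mulr_ge0 // exprMn t2.
by move: HN; move: N.+1%:R^-1 => u; lra.
Qed.

(** Pairing v_i w_j xi with Phi xi gives exactly delta_ij alpha_i, by [star_vw_Phi]. Replacing Phi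
    xi by xi costs |Phi xi - xi|, as v_i w_j is isometric. *)
Lemma approximate_embezzlement_value xi i j : hip xi xi = 1 ->
  cmod (hip ((v i * w j) xi) xi - (i == j)%:R * (alpha i)%:C) <= hn (Phi xi - xi).
Proof.
move=> xi1; have -> : (i == j)%:R * (alpha i)%:C = hip ((v i * w j) xi) (Phi xi).
  rewrite bop_starE -bop_mulE star_vw_Phi bop_scaleE bop_oneE hipZr xi1 mulr1.
  by rewrite rmorphM rmorph_nat /= conjc_realC.
rewrite -hipBr hn_distC; apply: le_trans (hip_Cauchy_Schwarz _ _) _.
have -> : hn ((v i * w j) xi) = 1.
  rewrite /hn bop_starE -bop_mulE starM -mulrA (mulrA (star (v i))) v_orth eqxx.
  by rewrite mul1r w_orth eqxx bop_oneE xi1 sqrtr1.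
by rewrite mul1r.
Qed.

End ApproximateEmbezzlement.

Lemma embezzling_state_exists (K : realType) (d : nat) (alpha : 'I_d -> K)
    (O T : cstarAlgType K[i]) (v : 'I_d -> O) (iL iR : O -> T) :
  (2 <= d)%N -> \sum_i alpha i ^+ 2 = 1 ->
  is_cuntz_algebra v -> is_max_tensor iL iR ->
  exists s : T -> K[i], is_state s /\ embezzles (alpha := alpha) s (iL \o v) (iR \o v).
Proof.
move=> hd alpha_norm HO HT; pose l := @shiftl K d hd; pose r := @shiftr K d hd.
have [h [hh hl hr]] := cuntz_tensor_hom HO HT (shifts_commuting hd).
(* Every pair in the range of l_i r_i has both last digits equal to i. Those of (0, 1) are 0 and 1,
   distinct because d >= 2. *)
pose psi := @ell2_delta K _ (0%N, 1%N).
have psi1 : hip (h := ell2_hspace (0%N, 0%N)) psi psi = 1.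
  exact: ell2_delta_unit.
have wand i : star (l i * r i) psi = 0.
  apply: ell2P => -[m n]; rewrite starM bop_mulE !shift_op_starE /=.
  case: eqP => //= -[/eqP]; rewrite addn_eq0 => /andP[_ /eqP ->] /eqP.
  by rewrite addn0 muln_eq1 => /andP[_ /eqP d1]; have : (1 < 1)%N by rewrite -{2}d1.
have pos n : (0 : K) < n.+1%:R^-1 by rewrite invr_gt0.
have /choice[xi Hxi] := fun n => approximate_embezzlement alpha_norm
  (shiftl_orth hd) (shiftr_orth hd) psi1 wand (pos n).
have [s ss sE] := state_limit (fun n => vector_state hh (Hxi n).1).
exists s; split => // i j; apply: sE => e e0.
have [N HN] := inv_succ_small e0; exists N => n /HN /ltW le_e.
have [_ hM _ _] := hh; have [xi1 xie] := Hxi n.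
have E : h ((iL \o v) i * (iR \o v) j) = l i * r j by rewrite hM /= hl hr.
rewrite E; apply: le_trans (le_trans xie le_e).
exact: (approximate_embezzlement_value (shiftl_orth hd) (shiftr_orth hd) i j xi1).
Qed.

(** * Embezzlement protocols *)

Section EmbezzlementRelations.
Context {K : realType} {d : nat} {alpha : 'I_d -> K} {V : hspace K}.
Local Notation C := K[i].
Hypotheses (alpha_gt0 : forall i, 0 < alpha i) (alpha_norm : \sum_i alpha i ^+ 2 = 1).
Context {P : set (bop V)} {r t : 'I_d -> bop V} {psi : V}.
Hypotheses (P1 : P 1) (Plin : forall c X Y, P X -> P Y -> P (c *: X + Y))
  (PM : forall X Y, P X -> P Y -> P (X * Y)) (Pstar : forall X, P X -> P (star X))
  (Pfaithful : forall X, P X -> X psi = 0 -> X = 0)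
  (Pr : forall i, P (r i))
  (r_contr : forall x, \sum_i hn (r i x) ^+ 2 <= hn x ^+ 2)
  (t_contr : forall x, \sum_i hn (t i x) ^+ 2 <= hn x ^+ 2)
  (psi_unit : hip psi psi = 1)
  (rt : forall i k, r i (t k psi) = ((i == k)%:R * (alpha i)%:C) *: psi)
  (tr : forall i k, t k (r i psi) = ((i == k)%:R * (alpha i)%:C) *: psi).

(** Applied with P the operators in M, then with P those in M' and r, t exchanged. The chain 1 = sum
    alpha_i^2 <= sum |r_i psi|^2 <= |psi|^2 = 1 is an equality, so the positive operator A = 1 - sum
    r_i^* r_i satisfies <A psi, psi> = 0. Cauchy-Schwarz for the form of A gives A psi = 0, and
    faithfulness A = 0. *)
Lemma embezzlement_column : \sum_i star (r i) * r i = 1.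
Proof.
pose A : bop V := 1 - \sum_i star (r i) * r i.
have As : star A = A.
  by rewrite starB star1 star_sum; congr (_ - _); apply: eq_bigr => i _; rewrite starM starK.
have PA : P A.
  have P0 : P 0 by rewrite -(addNr 1) -scaleN1r; exact: Plin.
  rewrite /A addrC -scaleN1r; apply: Plin => //.
  apply: (big_ind P) => // [X Y PX PY|i _]; first by rewrite -[X]scale1r; exact: Plin.
  exact/PM/Pr/Pstar/Pr.
have AE x : hip (A x) x = (hn x ^+ 2 - \sum_i hn (r i x) ^+ 2)%:C.
  rewrite bop_subE hipBl bop_sumE hip_suml rmorphB rmorph_sum /= -hip_hn.
  congr (_ - _); apply: eq_bigr => i _.
  by rewrite hip_conj -bop_starE hip_hn conjc_realC.
have psi1 : hn psi = 1 by rewrite /hn psi_unit sqrtr1.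
have sum1 : \sum_i hn (r i psi) ^+ 2 = 1.
  apply/eqP; rewrite eq_le (le_trans (r_contr psi)) ?psi1 ?expr1n //=.
  rewrite -[leLHS]alpha_norm; apply: ler_sum => i _.
  apply: le_trans (t_contr (r i psi)); rewrite (bigD1 i) //= tr eqxx mul1r.
  rewrite hnZ psi1 mulr1 cmod_real real_normK ?num_real // lerDl.
  by apply: sumr_ge0 => k _; exact: sqr_ge0.
have Apsi : A psi = 0.
  apply: hip_eq0; apply: cmod0_eq0; apply/eqP; rewrite -sqrf_eq0 eq_le sqr_ge0.
  rewrite andbT; apply: (le_trans (y := Re (hip (A psi) psi) * Re (hip (A (A psi)) (A psi)))).
    apply: (Cauchy_Schwarz_form (f := fun x y => hip (A x) y)) => [c x y z|x y|x].
    - by rewrite bop_linear hip_linear.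
    - by rewrite bop_starE As -hip_conj.
    - by rewrite AE ler0c subr_ge0.
  by rewrite AE psi1 sum1 expr1n subrr mul0r.
by have /subr0_eq/esym := Pfaithful PA Apsi.
Qed.

Lemma embezzlement_isometries : cuntz_isometries (star \o r).
Proof.
split=> [i|] /=; last by under eq_bigr do rewrite starK; exact: embezzlement_column.
(* Applying r_k to this identity yields r_k r_k^* psi = psi, as alpha_k is nonzero; faithfulness
   then removes psi. *)
have tE k : t k psi = (alpha k)%:C *: star (r k) psi.
  transitivity ((\sum_i star (r i) * r i) (t k psi)).
    by rewrite embezzlement_column.
  rewrite bop_sumE (bigD1 k) // big1 => [|j jk].
    by rewrite [LHS]addr0 bop_mulE rt eqxx mul1r bopZ.
  by rewrite bop_mulE rt (negbTE jk) mul0r scale0r bop0.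
rewrite starK; apply: subr0_eq; apply: Pfaithful.
  by rewrite addrC -scaleN1r; apply: Plin => //; apply: PM => //; exact: Pstar.
have := rt i i; rewrite tE bopZ eqxx mul1r bop_subE bop_oneE bop_mulE => h.
have ai : (alpha i)%:C != 0 by rewrite fmorph_eq0 gt_eqF.
by apply: (scalerI ai); rewrite scalerBr h subrr scaler0.
Qed.

End EmbezzlementRelations.

(** * Protocols, commutants and representations as statements about [bop] *)

Section Protocol.
Context {K : realType} {d : nat} {H : hilbertType K[i]}.
Local Notation C := K[i].
Implicit Types (M : set (H -> H)) (R T : 'I_d -> 'I_d -> H -> H).

Lemma bounded_op0 (X : H -> H) : bounded_op X -> X 0 = 0.
Proof.
by case=> Xl _; have := Xl (-1) 0 0; rewrite !scaleN1r oppr0 addr0 addNr.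
Qed.

Lemma block_op_single (X : 'I_d -> 'I_d -> H -> H) (j : 'I_d) (xi : 'I_d -> H) i :
  (forall k, bounded_op (X i k)) -> (forall k, k != j -> xi k = 0) ->
  block_op X xi i = X i j (xi j).
Proof.
move=> Xb xi0; rewrite /block_op (bigD1 j) //= big1 ?addr0 // => k kj.
by rewrite xi0 // bounded_op0.
Qed.

(** Coordinate (i, k) of the protocol equation: the initial vector is supported at (i0, i0), so only
    the column i0 of each block operator contributes. *)
Lemma protocol_entry (i0 : 'I_d) (alpha : 'I_d -> C) R T (psi : H) i k :
  (forall i j, bounded_op (R i j)) -> (forall i j, bounded_op (T i j)) ->
  ampl_left R (ampl_right T (basis_tensor i0 psi i0))
    = \sum_i alpha i *: basis_tensor i psi i ->
  R i i0 (T k i0 psi) = ((i == k)%:R * alpha i) *: psi.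
Proof.
move=> Rb Tb /(congr1 (fun f => f i k)).
rewrite /ampl_left (block_op_single (j := i0)) // => [|j ji]; last first.
  rewrite /ampl_right (block_op_single (j := i0)) //.
    by rewrite /basis_tensor (negbTE ji) bounded_op0.
  by move=> l _; rewrite /basis_tensor (negbTE ji).
rewrite /ampl_right (block_op_single (j := i0)) // => [|l li]; last first.
  by rewrite /basis_tensor (negbTE li) andbF.
rewrite /basis_tensor !eqxx => ->; rewrite !fct_sumE.
transitivity (\sum_j alpha j *: (if (i == j) && (k == j) then psi else 0)) => //.
rewrite (bigD1 i) //= eqxx big1 => [|j ji]; last first.
  by rewrite eq_sym (negbTE ji) scaler0.
by rewrite addr0 eq_sym; case: eqP => _; rewrite ?mul1r // mul0r scale0r scaler0.
Qed.

Lemma contraction_column (i0 : 'I_d) (X : 'I_d -> 'I_d -> H -> H) x :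
  (forall i j, bounded_op (X i j)) -> block_contraction X ->
  \sum_i `|X i i0 x| ^+ 2 <= `|x| ^+ 2.
Proof.
move=> Xb Xc; pose xi j : H := if j == i0 then x else 0.
have -> : \sum_i `|X i i0 x| ^+ 2 = \sum_i `|block_op X xi i| ^+ 2.
  apply: eq_bigr => i _; rewrite (block_op_single (j := i0)) // /xi ?eqxx //.
  by move=> k /negbTE ->.
apply: le_trans (Xc xi) _; rewrite (bigD1 i0) //= {1}/xi eqxx big1 ?addr0 // => k.
by move=> /negbTE ki; rewrite /xi ki normr0 expr0n.
Qed.

Section Representation.
Context {e : H} (e0 : e != 0).
Local Notation V := (hilbert_hspace e0).

Lemma bop_lift (I : Type) (X : I -> H -> H) : (forall i, bounded_op (X i)) ->
  exists Y : I -> bop V, forall i, X i = bfun (Y i).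
Proof.
move=> Xb; have /choice[Y XY] i : exists Y : bop V, X i = bfun Y.
  exact/(bounded_opP e0).
by exists Y.
Qed.

Lemma star_hom_representation (A : cstarAlgType C) (h : A -> bop V) :
  star_hom h -> is_representation (fun a => bfun (h a) : H -> H).
Proof.
case=> hl hM h1 hs; split; first by move=> a; apply/(bounded_opP e0); exists (h a).
split.
- move=> c a b; apply/funext => x; rewrite hl.
  by rewrite (bop_addE (c *: h a)) (bop_scaleE c (h a)).
- by move=> a b; rewrite hM.
- by rewrite h1.
- by move=> a; rewrite hs adj_bop.
Qed.

Lemma representation_star_hom (A : cstarAlgType C) (p : A -> H -> H) :
  is_representation p ->
  exists2 h : A -> bop V, star_hom h & p = (fun a => bfun (h a) : H -> H).
Proof.
move=> [pb [pl pM p1 ps]]; have [h ph] := bop_lift pb.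
exists h; last by apply/funext.
split.
- move=> c a b; apply: bopP => x; rewrite bop_addE bop_scaleE -!ph.
  by rewrite pl.
- by move=> a b; apply: bopP => x; rewrite bop_mulE -!ph pM.
- by apply: bopP => x; rewrite -ph p1.
- by move=> a; apply: bopP => x; rewrite -ph ps ph adj_bop.
Qed.

Section Commutant.
Context {N : set (H -> H)} (Nb : N `<=` bounded_op) (Nadj : forall X, N X -> N (adj X)).

Lemma commutant_bopP (X : bop V) :
  commutant N (bfun X : H -> H) <-> (forall Y : bop V, N (bfun Y) -> X * Y = Y * X).
Proof.
split=> [[_ XN] Y /XN XY|XN].
  by apply: bopP => x; rewrite !bop_mulE; exact: (congr1 (fun f => f x) XY).
split=> [|Z NZ]; first by apply/(bounded_opP e0); exists X.
have /(bounded_opP e0)[Y ZY] := Nb NZ; rewrite ZY in NZ *.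
by apply/funext => x; exact: (congr1 (fun B : bop V => B x) (XN Y NZ)).
Qed.

Lemma commutant_star (X : bop V) :
  commutant N (bfun X : H -> H) -> commutant N (bfun (star X) : H -> H).
Proof.
rewrite !commutant_bopP => XN Y NY; apply: (inv_inj starK).
by rewrite !starM starK XN // -adj_bop; exact: Nadj.
Qed.

Lemma commutant_lin (c : C) (X Y : bop V) : commutant N (bfun X : H -> H) ->
  commutant N (bfun Y : H -> H) -> commutant N (bfun (c *: X + Y) : H -> H).
Proof.
rewrite !commutant_bopP => XN YN Z NZ.
by rewrite mulrDl mulrDr -scalerAl -scalerAr XN ?YN.
Qed.

Lemma commutant_mul (X Y : bop V) : commutant N (bfun X : H -> H) ->
  commutant N (bfun Y : H -> H) -> commutant N (bfun (X * Y) : H -> H).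
Proof.
rewrite !commutant_bopP => XN YN Z NZ.
by rewrite -mulrA YN // !mulrA XN.
Qed.

Lemma commutant_one : commutant N (bfun (1 : bop V) : H -> H).
Proof. by rewrite commutant_bopP => Y _; rewrite mulr1 mul1r. Qed.

End Commutant.

Lemma commutant_adj (N : set (H -> H)) (S : H -> H) : N `<=` bounded_op ->
  (forall X, N X -> N (adj X)) -> commutant N S -> commutant N (adj S).
Proof.
move=> Nb Nadj SN; have /(bounded_opP e0)[X SX] := SN.1.
by rewrite SX adj_bop; apply: (commutant_star Nb Nadj); rewrite -SX.
Qed.

Lemma faithful_marginalP (N : set (H -> H)) (psi : H) (X : bop V) :
  faithful_marginal N psi -> N (bfun X : H -> H) -> X psi = 0 -> X = 0.
Proof.
move=> Nf NX X0; apply: bopP => x.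
apply: (congr1 (fun f : H -> H => f x) (_ : (bfun X : H -> H) = 0)).
apply: Nf => //=; rewrite adj_bop X0 -[LHS]/(hip (star X 0) (psi : V)).
by rewrite bop0 hip0l.
Qed.

End Representation.

End Protocol.

(** * Commuting Cuntz isometries from a protocol *)

Section ProtocolIsometries.
Context {K : realType} {d : nat} {alpha : 'I_d -> K} {i0 : 'I_d}.
Local Notation C := K[i].
Hypotheses (alpha_gt0 : forall i, 0 < alpha i) (alpha_norm : \sum_i alpha i ^+ 2 = 1).
Context {H : hilbertType C} {M : set (H -> H)} {R T : 'I_d -> 'I_d -> H -> H} {psi : H}.
Hypotheses (vnM : von_neumann_algebra M)
  (protocol : embezzlement_protocol i0 (fun i => (alpha i)%:C) M (commutant M) R T psi)
  (fM : faithful_marginal M psi) (fM' : faithful_marginal (commutant M) psi).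
Context (psi0 : psi != 0).
Local Notation V := (hilbert_hspace psi0).

Lemma protocol_isometries : exists r t : 'I_d -> bop V,
  [/\ forall i, R i i0 = bfun (r i), forall i, T i i0 = bfun (t i),
      commuting_isometries (star \o r) (star \o t)
    & forall i j, hip ((star (r i) * star (t j)) psi) (psi : V)
        = (i == j)%:R * (alpha i)%:C].
Proof.
have [RM TM [Rc Tc] psi1 eqn] := protocol; have [Mb Madj MM] := vnM.
have Rb i j : bounded_op (R i j) by exact/Mb.
have Tb i j : bounded_op (T i j) by case: (TM i j).
have [r rE] := bop_lift psi0 (fun i => Rb i i0).
have [t tE] := bop_lift psi0 (fun i => Tb i i0).
exists r, t.
have M'b : commutant M `<=` bounded_op by move=> X [].
have M'adj X : commutant M X -> commutant M (adj X).
  exact: (commutant_adj psi0 Mb Madj).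
have Mr i : M (bfun (r i) : H -> H) by rewrite -rE.
have M't i : commutant M (bfun (t i) : H -> H) by rewrite -tE.
have tr i j : t j * r i = r i * t j.
  exact: ((commutant_bopP Mb (t j)).1 (M't j) _ (Mr i)).
have tsr i j : t j * star (r i) = star (r i) * t j.
  apply: ((commutant_bopP Mb (t j)).1 (M't j)).
  by rewrite -adj_bop; exact: Madj.
have rtpsi i k : r i (t k psi) = ((i == k)%:R * (alpha i)%:C) *: (psi : V).
  have := protocol_entry i k Rb Tb eqn; rewrite rE tE; exact.
have trpsi i k : t k (r i psi) = ((i == k)%:R * (alpha i)%:C) *: (psi : V).
  by rewrite -bop_mulE tr bop_mulE rtpsi.
have psiV : hip (psi : V) psi = 1.
  by rewrite -[LHS]/(inner psi psi) inner_norm psi1 expr1n.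
have contr (X : 'I_d -> 'I_d -> H -> H) (Y : 'I_d -> bop V) :
    (forall i j, bounded_op (X i j)) -> block_contraction X ->
    (forall i, X i i0 = bfun (Y i)) ->
    forall x : V, \sum_i hn (Y i x) ^+ 2 <= hn x ^+ 2.
  move=> Xb Xc XY x; have := contraction_column i0 (x : H) Xb Xc.
  rewrite (@norm_hn _ _ _ psi0 x) -lecR rmorphXn rmorph_sum; congr (_ <= _).
  by apply: eq_bigr => i _; rewrite XY (@norm_hn _ _ _ psi0) rmorphXn.
have rc := contr R r Rb Rc rE; have tc := contr T t Tb Tc tE.
have riso : cuntz_isometries (star \o r).
  apply: (@embezzlement_isometries _ _ alpha _ alpha_gt0 alpha_norm
    [set X : bop V | M (bfun X : H -> H)] r t psi) => //.
  (* M is read as the commutant of its commutant, so the closure properties of commutants serve both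
     M and M'. *)
  - by rewrite /mkset -MM; exact: (commutant_one psi0 M'b).
  - by move=> c X Y; rewrite /mkset -MM; exact: (commutant_lin M'b).
  - by move=> X Y; rewrite /mkset -MM; exact: (commutant_mul M'b).
  - by move=> X; rewrite /mkset -MM; exact: (commutant_star M'b M'adj).
  - by move=> X; exact: faithful_marginalP.
have tiso : cuntz_isometries (star \o t).
  apply: (@embezzlement_isometries _ _ alpha _ alpha_gt0 alpha_norm
    [set X : bop V | commutant M (bfun X : H -> H)] t r psi) => //.
  - exact: (commutant_one psi0 Mb).
  - by move=> c X Y; exact: (commutant_lin Mb).
  - by move=> X Y; exact: (commutant_mul Mb).
  - by move=> X; exact: (commutant_star Mb Madj).
  - by move=> X; exact: faithful_marginalP.
  (* With r and t exchanged the coefficient carries the other index; the two agree on the diagonal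
     and vanish off it. *)
  - by move=> i k; rewrite trpsi eq_sym; case: eqP => [->|]; rewrite // !mul0r.
  - by move=> i k; rewrite rtpsi eq_sym; case: eqP => [->|]; rewrite // !mul0r.
split => //; first split => // [i j|i j] /=.
- by apply: (inv_inj starK); rewrite !starM !starK tr.
- by rewrite starK; apply: (inv_inj starK); rewrite !starM starK tsr.
move=> i j; rewrite bop_starE starM !starK bop_mulE trpsi hipZr psiV mulr1.
by rewrite rmorphM rmorph_nat /= conjc_realC.
Qed.

End ProtocolIsometries.

(** Since d >= 2, a second positive term keeps alpha_i^2 strictly below the total 1. *)
Lemma schmidt_lt1 (K : realType) (d : nat) (alpha : 'I_d -> K) : (2 <= d)%N ->
  (forall i, 0 < alpha i) -> \sum_i alpha i ^+ 2 = 1 -> forall i, 0 < alpha i < 1.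
Proof.
move=> hd a0 a1 i; rewrite a0 /=.
have [j ji] : exists j, j != i.
  case: (eqVneq i (Ordinal hd)) => [->|ii]; last by exists (Ordinal hd); rewrite eq_sym.
  by exists (Ordinal (ltnW hd)).
rewrite -(@expr_lt1 _ 2) ?(ltW (a0 i)) // -a1 (bigD1 i) //= (bigD1 j) //= ltrDl.
by rewrite ltr_pwDl ?exprn_gt0 // sumr_ge0 // => k _; exact: sqr_ge0.
Qed.

Local Open Scope complex_scope.

Theorem theorem3p4 (K : realType) (d : nat) (hd : (2 <= d)%N)
  (alpha : 'I_d -> K)
  (alpha_decr : forall i j : 'I_d, (i <= j)%N -> alpha j <= alpha i)
  (alpha_gt0 : forall i, 0 < alpha i)
  (alpha_norm : \sum_i alpha i ^+ 2 = 1)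
  (O : cstarAlgType K[i]) (v : 'I_d -> O) (HO : is_cuntz_algebra v)
  (OO : cstarAlgType K[i]) (iL iR : O -> OO) (HOO : is_max_tensor iL iR) :
  let i0 : 'I_d := Ordinal (ltnW hd) in
  exists s : OO -> K[i],
    unique (fun s' : OO -> K[i] => is_state s' /\
      forall i j, s' (elem_tensor iL iR (v i) (v j))
                  = (i == j)%:R * (alpha i)%:C) s /\
    forall (H : hilbertType K[i]) (M : set (H -> H))
      (R T : 'I_d -> 'I_d -> H -> H) (psi : H),
      von_neumann_algebra M ->
      embezzlement_protocol i0 (fun i => (alpha i)%:C)
        M (commutant M) R T psi ->
      faithful_marginal M psi ->
      faithful_marginal (commutant M) psi ->
      exists p : OO -> H -> H,
        unique (fun p' : OO -> H -> H =>
          [/\ is_representation p',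
              forall i, p' (elem_tensor iL iR (v i) 1) = adj (R i i0)
            & forall j, p' (elem_tensor iL iR 1 (v j)) = adj (T j i0)]) p /\
        forall X : OO, s X = inner (p X psi) psi.
Proof.
move=> i0; have a01 := schmidt_lt1 hd alpha_gt0 alpha_norm.
have [_ vgen _] := HO; have gen := max_tensor_generates vgen HOO.
have vw := cuntz_tensor_isometries HO HOO.
have [[_ _ L1 _] [_ _ R1 _] _ _ _] := HOO.
have tL a : elem_tensor iL iR a 1 = iL a by rewrite /elem_tensor R1 mulr1.
have tR a : elem_tensor iL iR 1 a = iR a by rewrite /elem_tensor L1 mul1r.
have [s [ss sE]] := embezzling_state_exists hd alpha_norm HO HOO.
have s_unique s' : is_state s' -> embezzles (alpha := alpha) s' (iL \o v) (iR \o v) -> s = s'.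
  by move=> ss' sE'; exact: (embezzling_state_unique alpha_norm vw a01 gen ss sE ss' sE').
exists s; split; first by split => // s' [ss' sE']; exact: s_unique.
move=> H M R T psi vnM protocol fM fM'.
(* The unit vector psi also serves as the base vector that turns H into an [hspace]. *)
have psi0 : psi != 0.
  have [_ _ _ psi1 _] := protocol; apply/eqP => psi0.
  by move: psi1; rewrite psi0 normr0 => /esym/eqP; rewrite oner_eq0.
have [r [t [rE tE rt rtpsi]]] :=
  protocol_isometries alpha_gt0 alpha_norm vnM protocol fM fM' psi0.
have [h [hh hL hR]] := cuntz_tensor_hom HO HOO rt.
exists (fun X => bfun (h X)); split; last first.
  (* The vector state of h at psi is an embezzling state, so uniqueness identifies it with s. *)
  move=> X; rewrite (s_unique (fun X => hip (h X psi) (psi : hilbert_hspace psi0))) //.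
    apply: vector_state => //; have [_ _ _ psi1 _] := protocol.
    by rewrite -[LHS]/(inner psi psi) inner_norm psi1 expr1n.
  by move=> i j /=; have [_ hM _ _] := hh; rewrite hM hL hR; exact: rtpsi.
split; first split.
- exact: star_hom_representation.
- by move=> i; rewrite tL hL rE adj_bop.
- by move=> j; rewrite tR hR tE adj_bop.
(* A competing representation is a *-homomorphism into the same [bop], so it is determined by its
   values on the generators. *)
move=> p [prep pL pR]; have [q qh pE] := representation_star_hom psi0 prep.
have bfun_inj (X Y : bop (hilbert_hspace psi0)) : bfun X = bfun Y :> (H -> H) -> X = Y.
  by move=> XY; apply: bopP => x; exact: (congr1 (fun f : H -> H => f x) XY).
rewrite pE in pL pR *; suff -> : h = q by [].
apply: star_hom_generates_eq gen _ => // x; rewrite inE => -[] [i _ <-] /=.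
  by apply: bfun_inj; have := pL i; rewrite tL hL rE adj_bop.
by apply: bfun_inj; have := pR i; rewrite tR hR tE adj_bop.
Qed.
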